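(* Let $(\mathrm{LinearP})$ be the problem $$\min\Big\{\mathbf{f}^\top\mathbf{x}+\sum_{s\in S}p_s\mathbf{q}_s^\top\mathbf{y}_s : A\mathbf{x}\le\mathbf{b},\ \mathbf{x}\in\mathbb{R}^{n_1}_+,\ \mathbf{y}_s\in\mathbb{R}^{n_2}_+,\ T_s\mathbf{x}+W_s\mathbf{y}_s\ge\mathbf{h}_s\ \forall s,\ \operatorname{CVaR}_\alpha(\mathbf{c}^\top\hat{\mathbf{G}}(\mathbf{x},\mathbf{y}))\le\operatorname{CVaR}_\alpha(\mathbf{c}^\top\mathbf{Z})\ \forall\mathbf{c}\in\mathcal{C}\Big\}$$ and $(\mathrm{LinearD})$ the problem of maximizing $$-\int_{\mathcal{C}}\operatorname{CVaR}_\alpha(\mathbf{c}^\top\mathbf{Z})\,\mu(\mathrm{d}\mathbf{c})-\boldsymbol\lambda^\top\mathbf{b}+\sum_{s\in S}p_s\boldsymbol\pi_s^\top\mathbf{h}_s$$ over $\boldsymbol\lambda\in\mathbb{R}^{m_1}_+$, $\mu\in\mathcal{M}^F_+(\mathcal{C})$, $\nu:\Omega\to\mathcal{M}^F_+(\mathcal{C})$, $\boldsymbol\pi_s\in\mathbb{R}^{m_2}_+$ ($s\in S$) subject to: (1) $\sum_{s}p_s\nu(\omega_s)=\mu$; (2) $\nu(\omega_s)\le\frac{\mu}{1-\alpha}$ (setwise) for all $s\in S$; (3) $\sum_s p_s\boldsymbol\pi_s^\top T_s-\sum_s p_s\int_{\mathcal{C}}\mathbf{c}^\top\bar{\mathbf{g}}_s\,[\nu(\omega_s)](\mathrm{d}\mathbf{c})\le\mathbf{f}^\top+\boldsymbol\lambda^\top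 A$; (4) $\boldsymbol\pi_s^\top W_s-\int_{\mathcal{C}}\mathbf{c}^\top\tilde{\mathbf{g}}_s\,[\nu(\omega_s)](\mathrm{d}\mathbf{c})\le\mathbf{q}_s^\top$ for all $s\in S$. Then $(\mathrm{LinearP})$ has a finite optimum value if and only if $(\mathrm{LinearD})$ does, in which case the two optimum values coincide. Moreover, a feasible solution $(\mathbf{x},\mathbf{y})$ of $(\mathrm{LinearP})$ and a feasible solution $(\boldsymbol\lambda,\mu,\nu,\boldsymbol\pi)$ of $(\mathrm{LinearD})$ are both optimal if and only if: (i) $\operatorname{support}(\mu)\subset\{\mathbf{c}:\operatorname{CVaR}_\alpha(\mathbf{c}^\top\hat{\mathbf{G}}(\mathbf{x},\mathbf{y}))=\operatorname{CVaR}_\alpha(\mathbf{c}^\top\mathbf{Z})\}$; (ii) $\operatorname{support}(\nu(\omega_s))\subset\{\mathbf{c}:\operatorname{VaR}_\alpha(\mathbf{c}^\top\hat{\mathbf{G}}(\mathbf{x},\mathbf{y}))\le\mathbf{c}^\top\hat{\mathbf{g}}_s(\mathbf{x},\mathbf{y}_s)\}$ for all $s\in S$; (iii) $\operatorname{support}(\frac{\mu}{1-\alpha}-\nu(\omega_s))\subset\{\mathbf{c}:\operatorname{VaR}_\alpha(\mathbf{c}^\top\hat{\mathbf{G}}(\mathbf{x},\mathbf{y}))\ge\mathbf{c}^\top\hat{\mathbf{g}}_s(\mathbf{x},\mathbf{y}_s)\}$ for all $s\in S$; (iv) $\boldsymbol\lambda^\top(\mathbf{b}-A\mathbf{x})=0$;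 (v) $\boldsymbol\pi_s^\top(T_s\mathbf{x}+W_s\mathbf{y}_s-\mathbf{h}_s)=0$ for all $s\in S$; (vi) $\big(\mathbf{f}^\top+\boldsymbol\lambda^\top A-\sum_sp_s\boldsymbol\pi_s^\top T_s+\sum_sp_s\int_{\mathcal{C}}\mathbf{c}^\top\bar{\mathbf{g}}_s\,[\nu(\omega_s)](\mathrm{d}\mathbf{c})\big)\mathbf{x}=0$; (vii) $\big(\mathbf{q}_s^\top-\boldsymbol\pi_s^\top W_s+\int_{\mathcal{C}}\mathbf{c}^\top\tilde{\mathbf{g}}_s\,[\nu(\omega_s)](\mathrm{d}\mathbf{c})\big)\mathbf{y}_s=0$ for all $s\in S$.
   Context: Finite probability space $\Omega=\{\omega_1,\dots,\omega_m\}$, $\Pi(\omega_s)=p_s>0$, $S=\{1,\dots,m\}$; smaller values are preferred. $\operatorname{CVaR}_\alpha(V)=\min_{\eta\in\mathbb{R}}\{\eta+\frac{1}{1-\alpha}\mathbb{E}[(V-\eta)_+]\}$ for $\alpha\in[0,1)$; $\operatorname{VaR}_\alpha(V)=\min\{t:\Pi(V\le t)\ge\alpha\}$. Benchmark $\mathbf{Z}$: random vector in $\mathbb{R}^d$ with finitely many realizations. $\mathcal{C}$: nonempty polyhedron contained in the unit simplex of $\mathbb{R}^d$. $\mathcal{M}^F_+(\mathcal{C})$: the set of finitely supported finite nonnegative measures on $\mathcal{C}$; for such $\mu$, $\operatorname{support}(\mu)=\{\mathbf{c}\in\mathcal{C}:\mu(\{\mathbf{c}\})>0\}$ and $\int_{\mathcal{C}}u(\mathbf{c})\mu(\mathrm{d}\mathbf{c})=\sum_{\mathbf{c}\in\operatorname{support}(\mu)}u(\mathbf{c})\mu(\{\mathbf{c}\})$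 (for vector-valued $u$, componentwise). Data: $A\in\mathbb{R}^{m_1\times n_1}$, $\mathbf{b}\in\mathbb{R}^{m_1}$, $\mathbf{f}\in\mathbb{R}^{n_1}$; for each $s$: $\mathbf{q}_s\in\mathbb{R}^{n_2}$, $T_s\in\mathbb{R}^{m_2\times n_1}$, $W_s\in\mathbb{R}^{m_2\times n_2}$, $\mathbf{h}_s\in\mathbb{R}^{m_2}$, $\bar{\mathbf{g}}_s\in\mathbb{R}^{d\times n_1}$, $\tilde{\mathbf{g}}_s\in\mathbb{R}^{d\times n_2}$, $\hat{\mathbf{g}}_s(\mathbf{x},\mathbf{y}_s)=\bar{\mathbf{g}}_s\mathbf{x}+\tilde{\mathbf{g}}_s\mathbf{y}_s$. $\hat{\mathbf{G}}(\mathbf{x},\mathbf{y})$ is the random vector with value $\hat{\mathbf{g}}_s(\mathbf{x},\mathbf{y}_s)$ at $\omega_s$. *)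

(* Defs.v *)
From HB Require Import structures.
From mathcomp Require Import all_boot all_order all_algebra.
From Stdlib Require Import ClassicalEpsilon.
Set Implicit Arguments. Unset Strict Implicit. Unset Printing Implicit Defensive.
Import Order.TTheory GRing.Theory Num.Theory.
Local Open Scope ring_scope.

(* A finite probability space with n atoms and weights p : 'I_n -> R;
   a random variable is V : 'I_n -> R. *)

Definition Expect (R : rcfType) n (p : 'I_n -> R) (V : 'I_n -> R) : R :=
  \sum_(s < n) p s * V s.

Definition Prob_le (R : rcfType) n (p : 'I_n -> R) (V : 'I_n -> R) (t : R) : R :=
  \sum_(s < n | V s <= t) p s.

Definition cvar_obj (R : rcfType) n (p : 'I_n -> R) (alpha : R) (V : 'I_n -> R)
  (eta : R) : R :=
  eta + (1 - alpha)^-1 * Expect p (fun s => Num.max (V s - eta) 0).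

Definition CVaR (R : rcfType) n (p : 'I_n -> R) (alpha : R) (V : 'I_n -> R) : R :=
  epsilon (inhabits 0)
    (fun v => (exists eta, v = cvar_obj p alpha V eta) /\
              (forall eta, v <= cvar_obj p alpha V eta)).

Definition is_VaR (R : rcfType) n (p : 'I_n -> R) (alpha : R) (V : 'I_n -> R)
  (t : R) : Prop :=
  alpha <= Prob_le p V t /\ (forall t', alpha <= Prob_le p V t' -> t <= t').

(* VaR_alpha(V); None means the minimum does not exist (only when alpha <= 0,
   where the value is -infinity). *)
Definition VaR (R : rcfType) n (p : 'I_n -> R) (alpha : R) (V : 'I_n -> R)
  : option R :=
  epsilon (inhabits None)
    (fun o => match o with
              | Some t => is_VaR p alpha V t
              | None => forall t, ~ is_VaR p alpha V t
              end).

(* VaR_alpha(V) <= t  and  VaR_alpha(V) >= t, with None read as -infinity *)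
Definition VaR_le (R : rcfType) n (p : 'I_n -> R) alpha (V : 'I_n -> R) (t : R) : Prop :=
  match VaR p alpha V with Some v => v <= t | None => True end.
Definition VaR_ge (R : rcfType) n (p : 'I_n -> R) alpha (V : 'I_n -> R) (t : R) : Prop :=
  match VaR p alpha V with Some v => t <= v | None => False end.

Definition lev (R : rcfType) a b (u v : 'M[R]_(a, b)) : Prop :=
  forall i j, u i j <= v i j.

Definition inPoly (R : rcfType) k d (P : 'M[R]_(k, d)) (w : 'cV[R]_k) (c : 'cV[R]_d) : Prop :=
  lev (P *m c) w.
Definition inSimplex (R : rcfType) d (c : 'cV[R]_d) : Prop :=
  (forall i, 0 <= c i 0) /\ \sum_(i < d) c i 0 = 1.

(* A finitely supported measure is given by a finite list of
   (atom, weight) pairs; mu(B) = sum of weights of atoms in B. *)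
Definition fsmeas (R : rcfType) d := seq ('cV[R]_d * R).

Definition fmass (R : rcfType) d (m : fsmeas R d) (B : pred 'cV[R]_d) : R :=
  \sum_(pw <- m | B pw.1) pw.2.

Definition fsm_on (R : rcfType) d (C : 'cV[R]_d -> Prop) (m : fsmeas R d) : Prop :=
  forall pw, pw \in m -> 0 <= pw.2 /\ C pw.1.

Definition fsupp (R : rcfType) d (m : fsmeas R d) (c : 'cV[R]_d) : Prop :=
  0 < fmass m (pred1 c).

Definition fint (R : rcfType) d (m : fsmeas R d) (u : 'cV[R]_d -> R) : R :=
  \sum_(pw <- m) u pw.1 * pw.2.
Definition fint_r (R : rcfType) d k (m : fsmeas R d) (u : 'cV[R]_d -> 'rV[R]_k) : 'rV[R]_k :=
  \sum_(pw <- m) pw.2 *: u pw.1.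

Record lp_data (R : rcfType) (d n1 n2 m1 m2 m : nat) := LPData {
  pr   : 'I_m -> R;
  Am   : 'M[R]_(m1, n1);
  bv   : 'cV[R]_m1;
  fv   : 'cV[R]_n1;
  qv   : 'I_m -> 'cV[R]_n2;
  Tm   : 'I_m -> 'M[R]_(m2, n1);
  Wm   : 'I_m -> 'M[R]_(m2, n2);
  hv   : 'I_m -> 'cV[R]_m2;
  gbar : 'I_m -> 'M[R]_(d, n1);
  gtil : 'I_m -> 'M[R]_(d, n2)
}.

Section Problems.
Context (R : rcfType) (d n1 n2 m1 m2 m : nat) (D : lp_data R d n1 n2 m1 m2 m).

Definition ghat (s : 'I_m) (x : 'cV[R]_n1) (ys : 'cV[R]_n2) : 'cV[R]_d :=
  gbar D s *m x + gtil D s *m ys.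

Definition cG (x : 'cV[R]_n1) (y : 'I_m -> 'cV[R]_n2) (c : 'cV[R]_d) : 'I_m -> R :=
  fun s => (c^T *m ghat s x (y s)) 0 0.

(* the random variable c^T Z, Z given by realizations z with probabilities r *)
Definition cZ nz (z : 'I_nz -> 'cV[R]_d) (c : 'cV[R]_d) : 'I_nz -> R :=
  fun k => (c^T *m z k) 0 0.

Definition primal_feas (alpha : R) nz (r : 'I_nz -> R) (z : 'I_nz -> 'cV[R]_d)
  (C : 'cV[R]_d -> Prop) (x : 'cV[R]_n1) (y : 'I_m -> 'cV[R]_n2) : Prop :=
  [/\ lev (Am D *m x) (bv D), lev 0 x, (forall s, lev 0 (y s)),
      (forall s, lev (hv D s) (Tm D s *m x + Wm D s *m y s)) &
      (forall c, C c -> CVaR (pr D) alpha (cG x y c) <= CVaR r alpha (cZ z c))].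

Definition primal_obj (x : 'cV[R]_n1) (y : 'I_m -> 'cV[R]_n2) : R :=
  ((fv D)^T *m x) 0 0 + \sum_(s < m) pr D s * (((qv D s)^T *m y s) 0 0).

Definition dual_lhs3 (nu : 'I_m -> fsmeas R d) (pi : 'I_m -> 'cV[R]_m2) : 'rV[R]_n1 :=
  \sum_(s < m) pr D s *: ((pi s)^T *m Tm D s)
  - \sum_(s < m) pr D s *: fint_r (nu s) (fun c => c^T *m gbar D s).

Definition dual_lhs4 (nu : 'I_m -> fsmeas R d) (pi : 'I_m -> 'cV[R]_m2) (s : 'I_m)
  : 'rV[R]_n2 :=
  (pi s)^T *m Wm D s - fint_r (nu s) (fun c => c^T *m gtil D s).

Definition dual_feas (alpha : R) (C : 'cV[R]_d -> Prop)
  (lam : 'cV[R]_m1) (mu : fsmeas R d) (nu : 'I_m -> fsmeas R d)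
  (pi : 'I_m -> 'cV[R]_m2) : Prop :=
  lev 0 lam /\ fsm_on C mu /\ (forall s, fsm_on C (nu s)) /\ (forall s, lev 0 (pi s)) /\
  (forall B, \sum_(s < m) pr D s * fmass (nu s) B = fmass mu B) /\
  (forall s B, fmass (nu s) B <= fmass mu B / (1 - alpha)) /\
  lev (dual_lhs3 nu pi) ((fv D)^T + lam^T *m Am D) /\
  (forall s, lev (dual_lhs4 nu pi s) (qv D s)^T).

Definition dual_obj (alpha : R) nz (r : 'I_nz -> R) (z : 'I_nz -> 'cV[R]_d)
  (lam : 'cV[R]_m1) (mu : fsmeas R d) (pi : 'I_m -> 'cV[R]_m2) : R :=
  - fint mu (fun c => CVaR r alpha (cZ z c)) - ((lam^T *m bv D) 0 0)
  + \sum_(s < m) pr D s * (((pi s)^T *m hv D s) 0 0).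

Definition opt_conds (alpha : R) nz (r : 'I_nz -> R) (z : 'I_nz -> 'cV[R]_d)
  (x : 'cV[R]_n1) (y : 'I_m -> 'cV[R]_n2)
  (lam : 'cV[R]_m1) (mu : fsmeas R d) (nu : 'I_m -> fsmeas R d)
  (pi : 'I_m -> 'cV[R]_m2) : Prop :=
  (forall c, fsupp mu c ->
         CVaR (pr D) alpha (cG x y c) = CVaR r alpha (cZ z c)) /\
      (forall s c, fsupp (nu s) c ->
         VaR_le (pr D) alpha (cG x y c) (cG x y c s)) /\
      (forall s c, 0 < fmass mu (pred1 c) / (1 - alpha) - fmass (nu s) (pred1 c) ->
         VaR_ge (pr D) alpha (cG x y c) (cG x y c s)) /\
      (lam^T *m (bv D - Am D *m x)) 0 0 = 0 /\
      (forall s, ((pi s)^T *m (Tm D s *m x + Wm D s *m y s - hv D s)) 0 0 = 0) /\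
      (((fv D)^T + lam^T *m Am D - dual_lhs3 nu pi) *m x) 0 0 = 0 /\
      (forall s, (((qv D s)^T - dual_lhs4 nu pi s) *m y s) 0 0 = 0).

End Problems.

Definition is_inf (R : rcfType) (X : Type) (F : X -> Prop) (g : X -> R) (v : R) : Prop :=
  (forall x, F x -> v <= g x) /\ (forall e, 0 < e -> exists x, F x /\ g x < v + e).
Definition is_sup (R : rcfType) (X : Type) (F : X -> Prop) (g : X -> R) (v : R) : Prop :=
  (forall x, F x -> g x <= v) /\ (forall e, 0 < e -> exists x, F x /\ v - e < g x).

(* Main.v *)
(* The CVaR constraint over all of C is equivalent to finitely many linear ones. On the
   benchmark side, CVaR(c^T Z) is the least value over (eta, v) of a linear objective on the
   polyhedron of triples (c, eta, v) with v >= 0 and v_k >= c^T z_k - eta, so it suffices to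
   test the generators of the corresponding cone (obtained by cutting the whole space with one
   half-space at a time); on the left, CVaR(V) is the maximum of E[b V] over a polytope
   of densities b, again finitely generated.  Farkas' lemma (Bartl's induction)
   applied to the resulting finite system together with "objective <= v" gives, for every v,
   either a primal point of value at most v or a multiplier certificate.  The multiplier of
   the pair (c, b) becomes an atom at c of mass E[b] in mu and b_s in nu(omega_s), so the
   certificate is a dual point of value above v, or a dual recession direction.  For the
   optimality conditions, the duality gap is a sum of nonnegative terms, one per condition;
   at an atom c the gap of the risk terms is, with eta a VaR of V = c^T G,
   sum_s p_s (nu_s (eta - V_s)_+ + (mu / (1 - alpha) - nu_s) (V_s - eta)_+). *)
Require Import Defs.
From HB Require Import structures.
From mathcomp Require Import all_boot all_order all_algebra.
From mathcomp Require Import ring lra.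
From Stdlib Require Import Classical ClassicalEpsilon FunctionalExtensionality.
Set Implicit Arguments. Unset Strict Implicit. Unset Printing Implicit Defensive.
Import Order.TTheory GRing.Theory Num.Theory.
Local Open Scope ring_scope.

(** * Farkas' lemma and finitely generated cones *)

Section Farkas.
Context (R : realFieldType).

Lemma scalar_morph (V : lmodType R) (f : V -> R) : scalar f ->
  [/\ f 0 = 0, (forall x y, f (x + y) = f x + f y) &
      (forall k x, f (k *: x) = k * f x)].
Proof.
move=> fl; have f0 : f 0 = 0.
  by have := fl (-1) 0 0; rewrite scaler0 addr0 mulN1r addNr.
split=> // [x y|k x]; first by have := fl 1 x y; rewrite scale1r mul1r.
by have := fl k x 0; rewrite !addr0 f0 addr0.
Qed.

(* In the inductive step, [x0] violates the conclusion for [s] alone; every functional is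
   replaced by its value at the projection of [x] along [x0] onto the kernel of [a i0]. *)
Lemma farkas_seq (V : lmodType R) (I : eqType) (s : seq I) :
  uniq s -> forall (a : I -> V -> R) (b : V -> R),
  (forall i, scalar (a i)) -> scalar b ->
  (forall x, (forall i, i \in s -> a i x <= 0) -> b x <= 0) ->
  exists k : I -> R, (forall i, 0 <= k i) /\
    forall x, b x = \sum_(i <- s) k i * a i x.
Proof.
elim: s => [_ a b _ bl ab|i0 s IH /= /andP[i0s us] a b al bl ab].
  exists (fun=> 0); split=> // x; rewrite big_nil.
  have [_ _ bZ] := scalar_morph bl.
  apply/eqP; rewrite eq_le ab //=.
  by have := ab (-1 *: x) (fun i => False_ind _ \o notF); rewrite bZ mulN1r oppr_le0.
case: (classic (forall x, (forall i, i \in s -> a i x <= 0) -> b x <= 0)) => [ab'|].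
  have [k [k0 kb]] := IH us a b al bl ab'.
  exists (fun i => if i == i0 then 0 else k i); split=> [i|x]; first by case: ifP.
  rewrite big_cons eqxx mul0r add0r kb.
  by apply: eq_big_seq => i /=; case: eqP => // ->; rewrite (negPf i0s).
move=> nab; have [x0 nx0] := not_all_ex_not _ _ nab.
have [ax0 bx0] := imply_to_and _ _ nx0.
have {}bx0 : 0 < b x0 by rewrite ltNge; apply/negP.
have a0 : 0 < a i0 x0.
  rewrite ltNge; apply: contraTN bx0 => a0; rewrite -leNgt; apply: ab => i.
  by rewrite inE => /predU1P[->|/ax0].
set c := (a i0 x0)^-1.
have c0 : 0 < c by rewrite invr_gt0.
pose a' i x := a i x - c * a i x0 * a i0 x.
pose b' x := b x - c * b x0 * a i0 x.
have al' i : scalar (a' i).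
  by move=> k u v /=; rewrite /a' !al; ring.
have bl' : scalar b' by move=> k u v /=; rewrite /b' bl al; ring.
have [|k [k0 kb]] := IH us a' b' al' bl'.
  move=> x ax; have sub (f : V -> R) : scalar f ->
      f (- (c * a i0 x) *: x0 + x) = f x - c * f x0 * a i0 x.
    by move=> ->; ring.
  rewrite /b' -sub //; apply: ab => i; rewrite inE sub // => /predU1P[->|/ax //].
  by rewrite /c mulVf ?gt_eqF // mul1r subrr.
have S0 : \sum_(i <- s) k i * a i x0 <= 0.
  rewrite big_seq; apply: sumr_le0 => i /ax0 h.
  by rewrite mulr_ge0_le0.
(* Expanding [b'] and [a'] in the identity for [b'] and collecting the terms in [a i0 x] forces this
   multiplier of [i0]. It is nonnegative because [b x0 > 0] and the sum is nonpositive. *)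
exists (fun i => if i == i0 then c * (b x0 - \sum_(i <- s) k i * a i x0) else k i).
split=> [i|x].
  by case: ifP => // _; rewrite mulr_ge0 ?ltW // subr_gt0 (le_lt_trans S0).
rewrite big_cons eqxx.
have -> : \sum_(j <- s) (if j == i0 then c * (b x0 - \sum_(i <- s) k i * a i x0)
   else k j) * a j x = \sum_(j <- s) k j * a j x.
  by apply: eq_big_seq => i /=; case: eqP => // ->; rewrite (negPf i0s).
have := kb x; rewrite /b' /a'.
under eq_bigr do rewrite mulrBr.
rewrite sumrB.
have -> : \sum_(i <- s) k i * (c * a i x0 * a i0 x) =
   c * a i0 x * \sum_(i <- s) k i * a i x0.
  by rewrite mulr_sumr; apply: eq_bigr => i _; ring.
by move/eqP; rewrite subr_eq => /eqP ->; ring.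
Qed.

(** Homogenise by a variable [t]: a point with [t > 0] and all [a i x <= b i * t] would give a
    solution after division by [t]. So these inequalities imply [t <= 0], and [farkas_seq] writes
    [t] as a combination of them, read off at [(x, 0)] and [(0, 1)]. *)
Lemma farkas_infeasible (V : lmodType R) (I : finType) (a : I -> V -> R)
    (b : I -> R) : (forall i, scalar (a i)) ->
  ~ (exists x, forall i, a i x <= b i) ->
  exists k : I -> R, [/\ forall i, 0 <= k i,
    forall x, \sum_i k i * a i x = 0 & \sum_i k i * b i < 0].
Proof.
move=> al inf.
pose a' i (xt : V * R^o) := a i xt.1 - b i * xt.2.
have al' i : scalar (a' i).
  move=> k [u s] [v t]; rewrite /a' /= al.
  by rewrite -[k *: s]/(k * s); ring.
have sl : scalar (fun xt : V * R^o => xt.2 : R) by [].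
have [|k [k0 kE]] := farkas_seq (index_enum_uniq I) al' sl.
  move=> [x t] /= h; rewrite leNgt; apply/negP => t0; apply: inf.
  exists (t^-1 *: x) => i; have [_ _ ->] := scalar_morph (al i).
  have := h i (mem_index_enum i); rewrite /a' /= subr_le0 => hi.
  by rewrite mulrC ler_pdivrMr.
exists k; split=> // [x|].
  have := kE (x, 0); rewrite /a' /= => h; rewrite [RHS]h.
  by apply: eq_bigr => i _; rewrite mulr0 subr0.
have := kE (0, 1); rewrite /a' /= => h.
rewrite -oppr_gt0 -sumrN (_ : \sum_i _ = 1) ?ltr01 // h.
by apply: eq_bigr => i _; have [-> _ _] := scalar_morph (al i); rewrite mulr1 sub0r mulrN.
Qed.

End Farkas.

Section Cone.
Context (R : realFieldType).

Inductive cone (V : lmodType R) (G : seq V) : V -> Prop :=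
| cone0 : cone G 0
| cone_cons k g v : 0 <= k -> g \in G -> cone G v -> cone G (k *: g + v).

Section ConeTheory.
Context (V : lmodType R).
Implicit Types (G : seq V) (u v w : V).

Lemma coneD G u v : cone G u -> cone G v -> cone G (u + v).
Proof.
move=> Gu Gv; elim: Gu => [|k g u' k0 gG _ IH]; first by rewrite add0r.
by rewrite -addrA; apply: cone_cons.
Qed.

Lemma coneZ G k u : 0 <= k -> cone G u -> cone G (k *: u).
Proof.
move=> k0; elim=> [|j g v j0 gG _ IH]; first by rewrite scaler0; apply: cone0.
by rewrite scalerDr scalerA; apply: cone_cons => //; rewrite mulr_ge0.
Qed.

Lemma cone_gen G g : g \in G -> cone G g.
Proof.
by move=> gG; rewrite -[g]addr0 -[g]scale1r; apply: cone_cons => //; apply: cone0.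
Qed.

(* Double description: keep the generators on the nonnegative side and add, for each pair
   [g], [h] on opposite sides, the point [a g *: h - a h *: g] of the hyperplane. *)
Lemma cone_halfspace G (a : V -> R) : scalar a ->
  exists G' : seq V, (forall g, g \in G' -> cone G g /\ 0 <= a g) /\
    forall x, cone G x -> 0 <= a x -> cone G' x.
Proof.
move=> al; have [a0 aD aZ] := scalar_morph al.
pose pos := [seq g <- G | 0 < a g].
pose neg := [seq g <- G | a g < 0].
pose mix := [seq a g *: h - a h *: g | g <- pos, h <- neg].
exists ([seq g <- G | 0 <= a g] ++ mix); set G' := _ ++ _; split=> [g|x].
  rewrite mem_cat => /orP[|/allpairsP[[u v] /= []]].
    by rewrite mem_filter => /andP[ag gG]; split=> //; apply: cone_gen.
  rewrite !mem_filter => /andP[au uG] /andP[av vG] ->; split.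
    rewrite -scaleNr; apply: coneD; apply: coneZ; rewrite ?oppr_ge0 ?ltW //;
    exact: cone_gen.
  by rewrite -scaleNr aD !aZ mulNr mulrC subrr.
have nonneg u : cone G' u -> 0 <= a u.
  elim=> [|k g v k0 gG' _ IH]; first by rewrite a0.
  rewrite aD aZ addr_ge0 // mulr_ge0 //; move: gG'.
  rewrite mem_cat => /orP[|/allpairsP[[g' h] /= [_ _ ->]]].
    by rewrite mem_filter => /andP[].
  by rewrite -scaleNr aD !aZ mulNr mulrC subrr.
(* Mixed generators lie on the hyperplane [a = 0], so a generator [g] of [G'] with [a g > 0] comes
   from [G] and its mixture with [h] is in [mix]. If [a g = 0], the mixture is a nonnegative
   multiple of [g]. *)
have pair u h : cone G' u -> h \in neg -> cone G' (a u *: h - a h *: u).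
  move=> Gu hN; have ah : a h < 0 by move: hN; rewrite mem_filter => /andP[].
  elim: Gu => [|k g v k0 gG' Gv IH].
    by rewrite a0 scale0r scaler0 subrr; apply: cone0.
  have -> : a (k *: g + v) *: h - a h *: (k *: g + v) =
      k *: (a g *: h - a h *: g) + (a v *: h - a h *: v).
    rewrite aD aZ scalerDl scalerDr scalerBr !scalerA opprD addrACA.
    by rewrite [a h * k]mulrC.
  apply: coneD => //; apply: coneZ => //; have [ag|ag] := ltP 0 (a g).
    apply: cone_gen; rewrite mem_cat; apply/orP.
    move: (gG'); rewrite mem_cat => /orP[|/allpairsP[[g' h'] /= [_ _ gE]]].
      rewrite mem_filter => /andP[_ gG]; right; apply/allpairsP.
      by exists (g, h); rewrite /= mem_filter ag gG.
    by move: ag; rewrite gE -scaleNr aD !aZ mulNr mulrC subrr ltxx.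
  have -> : a g = 0 by apply: le_anti; rewrite ag nonneg //; apply: cone_gen.
  by rewrite scale0r sub0r -scaleNr; apply: coneZ; rewrite ?oppr_ge0 ?ltW //;
     apply: cone_gen.
have pairN u w : cone G' u -> cone neg w -> cone G' (a u *: w - a w *: u).
  move=> Gu; elim=> [|k h v k0 hN _ IH].
    by rewrite a0 scale0r scaler0 subrr; apply: cone0.
  have -> : a u *: (k *: h + v) - a (k *: h + v) *: u =
      k *: (a u *: h - a h *: u) + (a u *: v - a v *: u).
    rewrite aD aZ scalerDl scalerDr scalerBr !scalerA opprD addrACA.
    by rewrite [a u * k]mulrC.
  by apply: coneD => //; apply: coneZ => //; apply: pair.
have negP w : cone neg w -> a w < 0 \/ w = 0.
  elim=> [|k h v k0]; first by right.
  rewrite mem_filter => /andP[ah _] _ IH.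
  move: k0; rewrite le_eqVlt => /predU1P[<-|k0].
    by rewrite scale0r add0r.
  have kah : k * a h < 0 by rewrite pmulr_rlt0.
  by left; rewrite aD aZ; case: IH => [av|->]; rewrite ?a0; lra.
move=> Gx ax; have [u [w [Gu Nw xE]]] : exists u w,
    [/\ cone G' u, cone neg w & x = u + w].
  elim: Gx {ax} => [|k g v k0 gG _ [u [w [Gu Nw ->]]]].
    by exists 0, 0; rewrite addr0; split=> //; apply: cone0.
  have [ag|ag] := ltP (a g) 0.
    exists u, (k *: g + w); rewrite addrCA; split=> //.
    by apply: cone_cons; rewrite // mem_filter ag.
  exists (k *: g + u), w; rewrite addrA; split=> //.
  by apply: cone_cons => //; rewrite mem_cat mem_filter ag gG.
have [aw|w0] := negP w Nw; last by rewrite xE w0 addr0.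
have au : 0 < a u by move: ax; rewrite xE aD; lra.
(* The negative part [w] is absorbed into a mixture with [u]; the remaining coefficient of [u] is
   [a x / a u >= 0]. *)
have -> : x = (a u)^-1 *: (a u *: w - a w *: u) + (1 + a w / a u) *: u.
  rewrite scalerBr !scalerA mulVf ?gt_eqF // scale1r scalerDl scale1r.
  by rewrite [_^-1 * _]mulrC [u + _]addrC addrA subrK addrC.
apply: coneD; apply: coneZ => //; first by rewrite invr_ge0 ltW.
  exact: pairN.
have -> : 1 + a w / a u = a x / a u by rewrite xE aD mulrDl divff ?gt_eqF.
by rewrite divr_ge0 // ltW.
Qed.

End ConeTheory.

(** Minkowski-Weyl theorem. A basis and its negatives generate the whole space, and each functional
    is imposed by [cone_halfspace]; the new generators lie in the old cone, so the earlier
    inequalities persist. *)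
Lemma cone_finitely_generated (V : vectType R) (I : finType) (a : I -> V -> R) :
  (forall i, scalar (a i)) ->
  exists G : seq V, (forall g, g \in G -> forall i, 0 <= a i g) /\
    forall x, (forall i, 0 <= a i x) -> cone G x.
Proof.
move=> al.
suff [G [Ga Gx]] : exists G : seq V,
    (forall g, g \in G -> forall i, i \in enum I -> 0 <= a i g) /\
    forall x, (forall i, i \in enum I -> 0 <= a i x) -> cone G x.
  exists G; split=> [g /Ga Gg i|x ax]; first by apply: Gg; rewrite mem_enum.
  by apply: Gx => i _.
elim: (enum I) => [|i s [G [Ga Gx]]].
  exists (vbasis fullv ++ [seq - b | b <- vbasis fullv]); split=> [g _ i|x _].
    by rewrite in_nil.
  rewrite (coord_vbasis (memvf x)).
  apply: (big_ind (fun y : V => cone _ y)) => [|u v|i _].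
  - exact: cone0.
  - exact: coneD.
  - set b := _`_i; have bB : b \in vbasis (fullv : {vspace V}).
      by rewrite mem_nth // size_tuple.
    have [c0|c0] := leP 0 (coord (vbasis fullv) i x).
      by apply: coneZ => //; apply: cone_gen; rewrite mem_cat bB.
    rewrite -[_ *: b]opprK -scaleNr -scalerN; apply: coneZ.
      by rewrite oppr_ge0 ltW.
    by apply: cone_gen; rewrite mem_cat map_f ?orbT.
have [a0 aD aZ] := scalar_morph (al i).
have [G' [G'a G'x]] := cone_halfspace G (al i).
exists G'; split=> [g /G'a[Gg ag] j|x ax].
  rewrite inE => /predU1P[->//|js]; have [b0 bD bZ] := scalar_morph (al j).
  elim: Gg {ag} => [|k u v k0 /Ga uj _ IH]; first by rewrite b0.
  by rewrite bD bZ addr_ge0 // mulr_ge0 // uj.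
apply: G'x; last by apply: ax; rewrite mem_head.
by apply: Gx => j js; apply: ax; rewrite inE js orbT.
Qed.

End Cone.

(** * CVaR, VaR and densities *)

Section CVaRTheory.
Context (R : rcfType) (n : nat) (p : 'I_n -> R) (alpha : R).
Hypotheses (p_ge0 : forall s, 0 <= p s) (p_sum1 : \sum_s p s = 1).
Hypotheses (alpha_ge0 : 0 <= alpha) (alpha_lt1 : alpha < 1).
Implicit Types (V b v : 'I_n -> R) (eta : R).

Let alpha1 : 0 < 1 - alpha. Proof. by rewrite subr_gt0. Qed.

(* Homogeneous, so that densities form a cone: a density in the usual sense has
   [Expect p b = 1]. *)
Definition density b := (forall s, 0 <= b s) /\
  (forall s, (1 - alpha) * b s <= Expect p b).

(** First-order condition for [eta] to minimise [cvar_obj p alpha V]. Every VaR satisfies it, and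
    such an [eta] exists even for [alpha = 0], where there is no VaR. *)
Definition quantile V eta :=
  alpha <= Prob_le p V eta /\ \sum_(s < n | V s < eta) p s <= alpha.

(** Weak duality for CVaR: bound [V s] by [eta + v s], then [b s] by [Expect p b / (1 - alpha)] in
    front of [v s]. Any majorant [v] of the positive part is allowed, as needed for points of the
    polyhedron in [finite_benchmark]. *)
Lemma Expect_density_le V b v eta : density b ->
  (forall s, 0 <= v s) -> (forall s, V s - eta <= v s) ->
  Expect p (fun s => b s * V s) <=
  Expect p b * (eta + (1 - alpha)^-1 * Expect p v).
Proof.
move=> [b0 b1] v0 vV; set S := Expect p b.
rewrite mulrDr mulrCA [S * Expect p v]mulr_sumr mulr_sumr mulr_suml -big_split /=.
apply: ler_sum => s _.
have vb : b s * v s <= (1 - alpha)^-1 * (S * v s).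
  by rewrite mulrA ler_wpM2r // mulrC ler_pdivlMr // mulrC.
have h : b s * V s <= b s * eta + (1 - alpha)^-1 * (S * v s).
  apply: le_trans (_ : b s * eta + b s * v s <= _); last by rewrite lerD2l.
  by rewrite -mulrDr ler_wpM2l // -lerBlDl.
by have := ler_wpM2l (p_ge0 s) h; rewrite mulrDr; lra.
Qed.

Lemma density_le_obj V b eta : density b -> Expect p b = 1 ->
  Expect p (fun s => b s * V s) <= cvar_obj p alpha V eta.
Proof.
move=> bd b1; have := @Expect_density_le V b (fun s => Num.max (V s - eta) 0) eta bd.
by rewrite b1 mul1r; apply=> s; rewrite le_max lexx ?orbT.
Qed.

(** The optimal density is [(1 - alpha)^-1] where [V > eta], zero where [V < eta], and a fraction
    [th] of the upper value where [V = eta]. *)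
Lemma quantile_density V eta : quantile V eta ->
  exists b, [/\ density b, Expect p b = 1 &
    Expect p (fun s => b s * V s) = cvar_obj p alpha V eta].
Proof.
move=> [q1 q2].
pose gt := \sum_(s < n | eta < V s) p s; pose eq := \sum_(s < n | V s == eta) p s.
have split1 : Prob_le p V eta + gt = 1.
  rewrite -p_sum1 (bigID (fun s => V s <= eta)) /=; congr +%R.
  by apply: eq_bigl => s; rewrite ltNge.
have split2 : \sum_(s < n | V s < eta) p s + eq = Prob_le p V eta.
  rewrite /Prob_le [RHS](bigID (fun s => V s < eta)) /=; congr +%R; apply: eq_bigl => s.
    by case: ltgtP.
  by case: ltgtP.
have eq0 : 0 <= eq by apply: sumr_ge0.
(* [th] makes the total mass one. The two quantile inequalities put it in [[0, 1]], and they force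
   [gt = 1 - alpha] when the level [V = eta] has no mass. *)
have [th [th0 th1 thE]] : exists th : R, [/\ 0 <= th, th <= 1 & gt + th * eq = 1 - alpha].
  have [eqz|eqz] := eqVneq eq 0.
    by exists 0; rewrite ler01 lexx; split=> //; lra.
  have eqp : 0 < eq by rewrite lt_def eqz.
  exists ((1 - alpha - gt) / eq); rewrite divfK // ler_pdivrMr // mul1r.
  by split; [apply: divr_ge0|..]; lra.
pose b s := (1 - alpha)^-1 * ((eta < V s)%R%:R + th * (V s == eta)%:R).
have b1 : Expect p b = 1.
  transitivity ((1 - alpha)^-1 * (gt + th * eq)); last first.
    by rewrite thE mulVf // gt_eqF.
  rewrite /Expect /gt /eq [\sum_(s < n | eta < V s) _]big_mkcond.
  rewrite [\sum_(s < n | V s == eta) _]big_mkcond /= mulr_sumr -big_split mulr_sumr.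
  apply: eq_bigr => s _ /=.
  by rewrite /b; case: ltgtP => _ /=; ring.
exists b; split=> //; first split=> s.
- by rewrite mulr_ge0 ?invr_ge0 ?(ltW alpha1) // addr_ge0 ?mulr_ge0.
- rewrite b1 /b mulVKf ?lt0r_neq0 //.
  by case: ltgtP => _ /=; rewrite ?mulr1 ?mulr0 ?add0r ?addr0.
- have -> : cvar_obj p alpha V eta = Expect p b * eta +
      (1 - alpha)^-1 * Expect p (fun s => Num.max (V s - eta) 0) by rewrite b1 mul1r.
  rewrite mulr_suml mulr_sumr -big_split.
  apply: eq_bigr => s _ /=; rewrite /b; case: (ltgtP (V s) eta) => h.
  + by rewrite max_r ?subr_le0 ?ltW //=; ring.
  + by rewrite max_l ?subr_ge0 ?ltW //=; ring.
  + by rewrite h subrr maxxx /=; ring.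
Qed.

Lemma quantile_min V eta eta' : quantile V eta ->
  cvar_obj p alpha V eta <= cvar_obj p alpha V eta'.
Proof. by move/quantile_density=> [b [bd b1 <-]]; apply: density_le_obj. Qed.

Lemma max_in_sublevel V (Q : pred R) s0 : Q (V s0) ->
  exists2 s, Q (V s) & forall t, Q (V t) -> V t <= V s.
Proof.
move=> Qs; case: (@arg_maxP _ _ _ s0 (fun s => Q (V s)) V Qs) => s Qs' max_s.
by exists s.
Qed.

(** If the values below [t] had mass above [alpha], the largest of them would already reach level
    [alpha], against the minimality of [t]. *)
Lemma is_VaR_quantile V t : is_VaR p alpha V t -> quantile V t.
Proof.
move=> [t1 t2]; split=> //; case: (pickP (fun s => V s < t)) => [s0 Vs0|none]; last first.
  by rewrite big_pred0.
have [s Vs smax] := @max_in_sublevel V (fun x => x < t) s0 Vs0.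
rewrite leNgt; apply/negP => gta.
suff /t2 : alpha <= Prob_le p V (V s) by rewrite leNgt Vs.
apply/ltW/(lt_le_trans gta); rewrite le_eqVlt; apply/orP; left; apply/eqP.
apply: eq_bigl => i; apply/idP/idP => [/smax//|h]; exact: le_lt_trans h Vs.
Qed.

Lemma ord_inhabited : exists s : 'I_n, True.
Proof.
case: n p p_sum1 => [q|k q _]; last by exists ord0.
by rewrite big_ord0 => /esym/eqP; rewrite oner_eq0.
Qed.

(** The distribution function jumps only at values of [V], so it suffices to minimise over these: a
    competitor [t'] has positive mass below it and can be lowered to the largest value of [V] not
    above it. *)
Lemma is_VaR_exists V : 0 < alpha -> exists t, is_VaR p alpha V t.
Proof.
move=> a0; have [s0 _] := ord_inhabited.
have [s _ smax] := @max_in_sublevel V predT s0 isT.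
have Ps : alpha <= Prob_le p V (V s).
  rewrite (_ : Prob_le _ _ _ = 1) ?ltW // -p_sum1; apply: eq_bigl => i.
  by rewrite smax.
case: (@arg_minP _ _ _ s (fun s => alpha <= Prob_le p V (V s)) V Ps) => e Pe emin.
exists (V e); split=> // t' Pt'; case: (pickP (fun s => V s <= t')) => [s1 Vs1|none]; last first.
  by move: Pt'; rewrite /Prob_le big_pred0 // leNgt a0.
have [s2 Vs2 s2max] := @max_in_sublevel V (fun x => x <= t') s1 Vs1.
apply: (le_trans _ Vs2); apply: emin; rewrite (le_trans Pt') // le_eqVlt; apply/orP; left.
apply/eqP; apply: eq_bigl => i; apply/idP/idP => [/s2max//|h]; exact: le_trans h Vs2.
Qed.

Lemma quantile_exists V : exists eta, quantile V eta.
Proof.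
have [a0|a0] := ltP 0 alpha.
  by have [t /is_VaR_quantile] := is_VaR_exists V a0; exists t.
(* For [alpha = 0] the least value of [V] serves, as nothing lies strictly below it. *)
have {}a0 : alpha = 0 by apply: le_anti; rewrite a0.
have [s0 _] := ord_inhabited.
case: (@arg_minP _ _ _ s0 predT V isT) => s _ smin.
exists (V s); rewrite /quantile a0; split; first exact: sumr_ge0.
by rewrite big_pred0 // => i; apply: le_gtF; apply: smin.
Qed.

Lemma CVaR_quantile V eta : quantile V eta -> CVaR p alpha V = cvar_obj p alpha V eta.
Proof.
move=> q.
have := epsilon_spec (inhabits (0 : R)) (fun u => (exists e, u = cvar_obj p alpha V e) /\
  (forall e, u <= cvar_obj p alpha V e)).
rewrite -/(CVaR p alpha V) => -[|[e ->] emin].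
  by exists (cvar_obj p alpha V eta); split=> [|e]; [exists eta | apply: quantile_min].
by apply: le_anti; rewrite emin quantile_min.
Qed.

Lemma CVaR_attained V : exists eta, CVaR p alpha V = cvar_obj p alpha V eta.
Proof. by have [e q] := quantile_exists V; exists e; apply: CVaR_quantile. Qed.

Lemma CVaR_density V : exists b, [/\ density b, Expect p b = 1 &
  CVaR p alpha V = Expect p (fun s => b s * V s)].
Proof.
have [e q] := quantile_exists V; have [b [bd b1 bE]] := quantile_density q.
by exists b; rewrite bE (CVaR_quantile q).
Qed.

Lemma VaR_spec V : match VaR p alpha V with
  | Some t => is_VaR p alpha V t
  | None => forall t, ~ is_VaR p alpha V t
  end.
Proof.
rewrite /VaR; apply: (epsilon_spec (inhabits None) (fun o => match o with
  | Some t => is_VaR p alpha V t | None => forall t, ~ is_VaR p alpha V t end)).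
have [[t tV]|none] := classic (exists t, is_VaR p alpha V t); first by exists (Some t).
by exists None => t tV; apply: none; exists t.
Qed.

Lemma VaR_Some V : 0 < alpha -> exists2 t, VaR p alpha V = Some t & is_VaR p alpha V t.
Proof.
move=> a0; have [t0 t0V] := is_VaR_exists V a0; have := VaR_spec V.
by case: (VaR p alpha V) => [t tV|/(_ t0)//]; exists t.
Qed.

Lemma VaR_None V : alpha = 0 -> VaR p alpha V = None.
Proof.
move=> a0; have := VaR_spec V; case: (VaR p alpha V) => // t [_ /(_ (t - 1))].
have P0 : alpha <= Prob_le p V (t - 1) by rewrite a0; apply: sumr_ge0.
by move=> /(_ P0) h; exfalso; lra.
Qed.

(** * Slack of the risk terms at a single atom *)

Section AtomSlack.
Context (V nu : 'I_n -> R).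
Let mu := Expect p nu.
Hypotheses (nu_ge0 : forall s, 0 <= nu s) (nu_le : forall s, nu s <= mu / (1 - alpha)).

(** Here [nu s] stands for the mass of the measure of scenario [s] at one point. As [mu] is the mean
    of [nu], [eta * mu] is the mean of [nu s * eta], and [eta - V s] is split into its positive and
    negative parts. *)
Lemma atom_slackE eta : quantile V eta ->
  CVaR p alpha V * mu - Expect p (fun s => nu s * V s) =
  \sum_s p s * (nu s * Num.max (eta - V s) 0 +
                (mu / (1 - alpha) - nu s) * Num.max (V s - eta) 0).
Proof.
move=> q; rewrite (CVaR_quantile q) /cvar_obj mulrDl {1}/mu [eta * _]mulr_sumr.
rewrite [(1 - alpha)^-1 * _]mulrC -mulrA [_^-1 * mu]mulrC mulr_suml -big_split -sumrB /=.
apply: eq_bigr => s _; have [h|h] := leP (V s) eta.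
  by rewrite (max_l (x := eta - V s)) ?subr_ge0 // max_r ?subr_le0 //; ring.
by rewrite (max_r (x := eta - V s)) ?subr_le0 ?ltW // max_l ?subr_ge0 ?ltW //; ring.
Qed.

Lemma atom_slack_ge0 : 0 <= CVaR p alpha V * mu - Expect p (fun s => nu s * V s).
Proof.
have [eta q] := quantile_exists V; rewrite (atom_slackE q).
apply: sumr_ge0 => s _; rewrite mulr_ge0 // addr_ge0 // mulr_ge0 ?subr_ge0 //.
  by rewrite le_max lexx orbT.
by rewrite le_max lexx orbT.
Qed.

(** For [alpha > 0], take [eta] to be the VaR in [atom_slackE]: the sum vanishes exactly when every
    term does. For [alpha = 0] both sides always hold. *)
Lemma atom_slack_eq0 : (forall s, 0 < p s) ->
  CVaR p alpha V * mu - Expect p (fun s => nu s * V s) = 0 <->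
  (forall s, 0 < nu s -> VaR_le p alpha V (V s)) /\
  (forall s, 0 < mu / (1 - alpha) - nu s -> VaR_ge p alpha V (V s)).
Proof.
move=> p_gt0; have [a0|a0] := eqVneq alpha 0; last first.
  have {}a0 : 0 < alpha by rewrite lt_def a0.
  have [eta etaE /is_VaR_quantile q] := VaR_Some V a0.
  rewrite /VaR_le /VaR_ge etaE (atom_slackE q).
  have max0 (x : R) : 0 <= Num.max x 0 by rewrite le_max lexx orbT.
  have term0 s : 0 <= nu s * Num.max (eta - V s) 0 +
                (mu / (1 - alpha) - nu s) * Num.max (V s - eta) 0.
    by rewrite addr_ge0 // mulr_ge0 ?subr_ge0.
  split=> [/eqP|[H1 H2]].
    rewrite psumr_eq0 => [/allP h|s _]; last by rewrite mulr_ge0.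
    have {}h s : nu s * Num.max (eta - V s) 0 == 0 /\
        (mu / (1 - alpha) - nu s) * Num.max (V s - eta) 0 == 0.
      have := h s (mem_index_enum s); rewrite mulf_eq0 gt_eqF //= paddr_eq0 //.
      - by move=> /andP[].
      - by rewrite mulr_ge0.
      - by rewrite mulr_ge0 ?subr_ge0.
    split=> s s0; have [h1 h2] := h s.
      move: h1; rewrite mulf_eq0 gt_eqF //= => /eqP h1.
      by rewrite -subr_le0 -h1 le_max lexx.
    move: h2; rewrite mulf_eq0 gt_eqF //= => /eqP h2.
    by rewrite -subr_le0 -h2 le_max lexx.
  apply: big1 => s _.
  have -> : nu s * Num.max (eta - V s) 0 = 0.
    have := nu_ge0 s; rewrite le_eqVlt => /predU1P[<-|/H1 h]; first by rewrite mul0r.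
    by rewrite max_r ?mulr0 // subr_le0.
  have -> : (mu / (1 - alpha) - nu s) * Num.max (V s - eta) 0 = 0.
    have := nu_le s; rewrite -subr_ge0 le_eqVlt => /predU1P[<-|/H2 h].
      by rewrite mul0r.
    by rewrite max_r ?mulr0 // subr_le0.
  by rewrite addr0 mulr0.
have mu1 : mu / (1 - alpha) = mu by rewrite a0 subr0 divr1.
(* Each [nu s] is at most their mean [mu], and all probabilities are positive, so [nu] is
   constant. *)
have nuE s : nu s = mu.
  have /eqP : \sum_s p s * (mu - nu s) = 0.
    under eq_bigr do rewrite mulrBr.
    by rewrite sumrB -mulr_suml p_sum1 mul1r subrr.
  rewrite psumr_eq0 => [/allP/(_ s (mem_index_enum s))|i _].
    by rewrite mulf_eq0 gt_eqF //= subr_eq0 => /eqP.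
  by rewrite mulr_ge0 // subr_ge0 -mu1.
(* With [VaR] equal to [None], [VaR_le] is true and [VaR_ge] is false, but the premise of the latter
   reads [0 < 0]. The slack is computed at the least value of [V]. *)
split=> [_|_].
  by split=> s; rewrite ?/VaR_le ?VaR_None // mu1 nuE subrr ltxx.
have [s0 _] := ord_inhabited.
case: (@arg_minP _ _ _ s0 predT V isT) => s _ smin.
have q : quantile V (V s).
  split; first by rewrite a0; apply: sumr_ge0.
  by rewrite big_pred0 // => i; apply: le_gtF; apply: smin.
rewrite (atom_slackE q); apply: big1 => i _.
by rewrite mu1 nuE subrr mul0r addr0 max_r ?mulr0 // subr_le0 smin.
Qed.

End AtomSlack.
End CVaRTheory.

(** * Reduction to finitely many constraints *)

Section FiniteReduction.
Context (R : rcfType).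

(** The densities form a polyhedral cone; its generators suffice because the tested inequality is
    linear in [b], and the CVaR is attained at some density of mass one. *)
Lemma finite_densities n (p : 'I_n -> R) alpha :
  (forall s, 0 <= p s) -> \sum_s p s = 1 -> 0 <= alpha -> alpha < 1 ->
  exists bs : seq 'cV[R]_n,
    (forall b, b \in bs -> density p alpha (fun s => b s 0)) /\
    forall (V : 'I_n -> R) t,
      (forall b, b \in bs -> Expect p (fun s => b s 0 * V s) <=
                             Expect p (fun s => b s 0) * t) ->
      CVaR p alpha V <= t.
Proof.
move=> p0 p1 al0 al1.
pose a (i : 'I_n + 'I_n) (b : 'cV[R]_n) : R := match i with
  | inl s => b s 0
  | inr s => Expect p (fun s => b s 0) - (1 - alpha) * b s 0 end.
have EZ k (b b' : 'cV[R]_n) (V : 'I_n -> R) :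
    Expect p (fun s => (k *: b + b') s 0 * V s) =
    k * Expect p (fun s => b s 0 * V s) + Expect p (fun s => b' s 0 * V s).
  rewrite /Expect mulr_sumr -big_split; apply: eq_bigr => s _ /=.
  by rewrite !mxE; ring.
have E1 (b : 'cV[R]_n) : Expect p (fun s => b s 0) = Expect p (fun s => b s 0 * 1).
  by apply: eq_bigr => s _; rewrite mulr1.
have al i : scalar (a i).
  case: i => s k b b' /=; rewrite ?E1 ?EZ !mxE //.
  by ring.
have [G [Ga Gx]] := cone_finitely_generated al.
exists G; split=> [g /Ga ga|V t ht].
  split=> s; first exact: ga (inl s).
  by have := ga (inr s); rewrite /= subr_ge0.
have [b [[b0 b1] bS ->]] := CVaR_density p0 p1 al0 al1 V.
have bE : Expect p (fun s => (\col_s b s) s 0 : R) = 1.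
  by rewrite -bS; apply: eq_bigr => s _; rewrite mxE.
have /Gx Gb : forall i, 0 <= a i (\col_s b s).
  case=> s /=; rewrite ?bE mxE //.
  by rewrite subr_ge0 (le_trans (b1 s)) ?bS.
have h u : cone G u -> Expect p (fun s => u s 0 * V s) <=
      Expect p (fun s => u s 0) * t.
  elim=> [|k g v k0 gG _ IH].
    rewrite /Expect big1 => [|s _]; last by rewrite mxE mul0r mulr0.
    by rewrite big1 ?mul0r // => s _; rewrite mxE mulr0.
  rewrite E1 !EZ -!E1 mulrDl -mulrA lerD // ler_wpM2l //; exact: ht.
have := h _ Gb.
rewrite bE mul1r.
by congr (_ <= _); apply: eq_bigr => s _; rewrite mxE.
Qed.

Context (d nz kC : nat) (r : 'I_nz -> R) (z : 'I_nz -> 'cV[R]_d) (alpha : R).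
Context (P : 'M[R]_(kC, d)) (w : 'cV[R]_kC).
Hypotheses (alpha_ge0 : 0 <= alpha) (alpha_lt1 : alpha < 1).
Hypotheses (r_ge0 : forall k, 0 <= r k) (r_sum1 : \sum_k r k = 1).
Hypotheses (C_nonempty : exists c, inPoly P w c)
  (C_simplex : forall c, inPoly P w c -> inSimplex c).

(** Such a [c] is a recession direction of a polyhedron inside the simplex: its entries cannot be
    negative, and they sum to zero. *)
Lemma recession_eq0 (c : 'cV[R]_d) : \sum_i c i 0 = 0 -> (forall i, (P *m c) i 0 <= 0) -> c = 0.
Proof.
move=> c0 Pc; have [e eC] := C_nonempty.
have ray t : 0 <= t -> inPoly P w (e + t *: c).
  move=> t0 i j; rewrite mulmxDr -scalemxAr !mxE (ord1 j).
  have := eC i 0; have := Pc i; rewrite !mxE => h1 h2.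
  by rewrite -[w i 0]addr0 lerD // mulr_ge0_le0.
have cge0 i : 0 <= c i 0.
  rewrite leNgt; apply/negP => ci.
  have ei : 0 <= e i 0 by have [] := C_simplex eC.
  (* At this parameter the ray has [i]-th coordinate -1, outside the simplex. *)
  have t0 : 0 <= (e i 0 + 1) / - c i 0.
    by rewrite divr_ge0 ?addr_ge0 // oppr_ge0 ltW.
  have [/(_ i)] := C_simplex (ray _ t0); rewrite !mxE invrN mulrN mulNr.
  by rewrite divfK ?lt_eqF //; lra.
apply/matrixP => i j; rewrite (ord1 j) mxE; move/eqP: c0.
by rewrite psumr_eq0 => [/allP/(_ i (mem_index_enum i))/eqP|k _].
Qed.

(** It is applied with [F c] the expectation of [c^T G] under a density and [B] the mass of that
    density. The inequality is proved on the whole cone of triples [(c, v, eta)], where its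
    right-hand side is linear. *)
Lemma finite_benchmark : exists cs : seq 'cV[R]_d,
  (forall c, c \in cs -> inPoly P w c) /\
  forall (F : 'cV[R]_d -> R) (B : R), scalar F -> 0 <= B ->
    (forall c, c \in cs -> F c <= B * CVaR r alpha (cZ z c)) ->
    forall c, inPoly P w c -> F c <= B * CVaR r alpha (cZ z c).
Proof.
pose VQ : vectType R := ('cV[R]_d * 'cV[R]_nz * R^o)%type.
(* On the polyhedron the entries of [c] sum to one, so their sum serves as the homogenising variable
   of [P *m c <= w]. *)
pose a (i : unit + 'I_kC + ('I_nz + 'I_nz)) (X : VQ) : R := match i with
  | inl (inl _) => \sum_i X.1.1 i 0
  | inl (inr i) => (\sum_i X.1.1 i 0) * w i 0 - (P *m X.1.1) i 0
  | inr (inl k) => X.1.2 k 0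
  | inr (inr k) => X.1.2 k 0 + X.2 - cZ z X.1.1 k end.
have sumZ k (c c' : 'cV[R]_d) :
    \sum_i (k *: c + c') i 0 = k * (\sum_i c i 0) + \sum_i c' i 0.
  by rewrite mulr_sumr -big_split; apply: eq_bigr => i _; rewrite !mxE.
have cZZ k (c c' : 'cV[R]_d) j : cZ z (k *: c + c') j = k * cZ z c j + cZ z c' j.
  by rewrite /cZ linearP /= mulmxDl -scalemxAl !mxE.
have cZZ0 k (c : 'cV[R]_d) j : cZ z (k *: c) j = k * cZ z c j.
  by rewrite /cZ linearZ /= -scalemxAl !mxE.
have al i : scalar (a i).
  case: i => [[[]|i]|[j|j]] k [[c v] e] [[c' v'] e'] /=; rewrite ?sumZ //.
  - by rewrite mulmxDr -scalemxAr !mxE; ring.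
  - by rewrite !mxE.
  - by rewrite cZZ !mxE -[k *: e]/(k * e); ring.
have [G [Ga Gx]] := cone_finitely_generated al.
pose mass (g : VQ) : R := \sum_i g.1.1 i 0.
exists [seq (mass g)^-1 *: g.1.1 | g <- G & 0 < mass g]; split.
  move=> c /mapP[g]; rewrite mem_filter => /andP[mg /Ga ga ->] i j.
  rewrite (ord1 j) -scalemxAr mxE mulrC ler_pdivrMr // mulrC.
  by have := ga (inl (inr i)); rewrite /= subr_ge0.
move=> F B Fl B0 Fcs c cC; have [F0 FD FZ] := scalar_morph Fl.
(* The factor [k] is there to normalise a generator to mass one. *)
have obj (g : VQ) : (forall i, 0 <= a i g) -> forall k, 0 <= k ->
    CVaR r alpha (cZ z (k *: g.1.1)) <=
      k * (g.2 + (1 - alpha)^-1 * Expect r (fun k => g.1.2 k 0)).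
  move=> ga k k0.
  have [b [bd b1 ->]] := CVaR_density r_ge0 r_sum1 alpha_ge0 alpha_lt1
    (cZ z (k *: g.1.1)).
  have h := @Expect_density_le R nz r alpha r_ge0 alpha_lt1 (cZ z g.1.1) b
    (fun k => g.1.2 k 0) g.2 bd.
  rewrite (_ : Expect r _ = k * Expect r (fun s => b s * cZ z g.1.1 s)).
    rewrite ler_wpM2l //; rewrite b1 mul1r in h; apply: h => j.
      exact: ga (inr (inl j)).
    by have := ga (inr (inr j)) => /=; lra.
  by rewrite mulr_sumr; apply: eq_bigr => j _; rewrite cZZ0; ring.
have gen (X : VQ) : cone G X ->
    F X.1.1 <= B * (X.2 + (1 - alpha)^-1 * Expect r (fun k => X.1.2 k 0)).
  elim=> [|k g X' k0 gG _ IH] /=.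
    rewrite F0 add0r /Expect big1 ?mulr0 // => k _; by rewrite mxE mulr0.
  have gE : F g.1.1 <= B * (g.2 + (1 - alpha)^-1 * Expect r (fun k => g.1.2 k 0)).
    have ga := Ga _ gG; have mg : 0 <= mass g := ga (inl (inl tt)).
    move: mg; rewrite le_eqVlt => /predU1P[mg|mg].
      (* A generator of mass zero has no [c] part, so its inequality only asks for a nonnegative
         objective, which follows from the CVaR of zero being zero. *)
      have c0 : g.1.1 = 0.
        apply: recession_eq0 => [|i]; first exact: esym mg.
        have := ga (inl (inr i)); rewrite /= -/(mass g) -mg mul0r sub0r.
        by rewrite oppr_ge0.
      rewrite c0 F0 mulr_ge0 //; have := obj _ ga 1 ler01; rewrite mul1r; apply: le_trans.
      have [b [bd b1 ->]] := CVaR_density r_ge0 r_sum1 alpha_ge0 alpha_lt1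
        (cZ z (1 *: g.1.1)).
      by rewrite /Expect sumr_ge0 // => j _; rewrite cZZ0 c0 /cZ trmx0 mul0mx mxE !mulr0.
    have /Fcs : (mass g)^-1 *: g.1.1 \in [seq (mass g)^-1 *: g.1.1 | g <- G & 0 < mass g].
      by apply/mapP; exists g; rewrite // mem_filter mg.
    rewrite FZ => /le_trans h; have im0 : 0 <= (mass g)^-1 by rewrite invr_ge0 ltW.
    have := h _ (ler_wpM2l B0 (obj _ ga _ im0)).
    by rewrite mulrCA ler_pM2l ?invr_gt0.
  rewrite Fl -[k *: g.2]/(k * g.2).
  rewrite (_ : Expect r _ = k * Expect r (fun k => g.1.2 k 0) +
    Expect r (fun k => X'.1.2 k 0)).
    by have := ler_wpM2l k0 gE; lra.
  by rewrite mulr_sumr -big_split; apply: eq_bigr => j _ /=; rewrite !mxE; ring.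
have [eta etaE] := CVaR_attained r_ge0 r_sum1 alpha_ge0 alpha_lt1 (cZ z c).
(* With [eta] optimal and [v] the positive part, the objective at [X] is exactly the CVaR. *)
pose X : VQ := (c, \col_k Num.max (cZ z c k - eta) 0, eta).
have [c0 c1] := C_simplex cC.
have /Gx/gen /= : forall i, 0 <= a i X.
  case=> [[[]|i]|[k|k]] /=; rewrite ?c1 ?ler01 //.
  - by rewrite mul1r subr_ge0; apply: cC.
  - by rewrite mxE le_max lexx orbT.
  - have : cZ z c k - eta <= Num.max (cZ z c k - eta) 0 by rewrite le_max lexx.
    by rewrite mxE; lra.
rewrite etaE /cvar_obj; congr (_ <= _ * (_ + _ * _)).
by apply: eq_bigr => k _; rewrite mxE.
Qed.

End FiniteReduction.

(** * Finitely supported measures *)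

Section Measures.
Context (R : rcfType) (d : nat).
Implicit Types (m : fsmeas R d) (C : 'cV[R]_d -> Prop).

Definition fscale k m : fsmeas R d := [seq (pw.1, k * pw.2) | pw <- m].

Lemma fmass_cat m m' B : fmass (m ++ m') B = fmass m B + fmass m' B.
Proof. exact: big_cat. Qed.

Lemma fint_cat m m' u : fint (m ++ m') u = fint m u + fint m' u.
Proof. exact: big_cat. Qed.

Lemma fmass_scale k m B : fmass (fscale k m) B = k * fmass m B.
Proof. by rewrite /fmass big_map mulr_sumr. Qed.

Lemma fint_scale k m u : fint (fscale k m) u = k * fint m u.
Proof. by rewrite /fint big_map mulr_sumr; apply: eq_bigr => pw _; rewrite mulrCA. Qed.

Lemma fintB m u v : fint m (fun c => u c - v c) = fint m u - fint m v.
Proof. by rewrite /fint -sumrB; apply: eq_bigr => pw _; rewrite mulrBl. Qed.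

Lemma fsm_on_cat C m m' : fsm_on C m -> fsm_on C m' -> fsm_on C (m ++ m').
Proof. by move=> Cm Cm' pw; rewrite mem_cat => /orP[/Cm|/Cm']. Qed.

Lemma fsm_on_scale C k m : 0 <= k -> fsm_on C m -> fsm_on C (fscale k m).
Proof. by move=> k0 Cm pw /mapP[q /Cm[q0 qC] ->]; rewrite mulr_ge0. Qed.

Lemma fmass_ge0 C m B : fsm_on C m -> 0 <= fmass m B.
Proof.
by move=> Cm; rewrite /fmass big_seq_cond; apply: sumr_ge0 => pw /andP[/Cm[]].
Qed.

Lemma fint_ge0 C m u : fsm_on C m -> (forall c, C c -> 0 <= u c) -> 0 <= fint m u.
Proof.
move=> Cm u0; rewrite /fint big_seq; apply: sumr_ge0 => pw /Cm[pw0 pwC].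
by rewrite mulr_ge0 ?u0.
Qed.

(** The list may repeat an atom or give it weight zero; a point is in the support exactly when it
    occurs with some positive weight. *)
Lemma fint_eq0 C m u : fsm_on C m -> (forall c, C c -> 0 <= u c) ->
  fint m u = 0 <-> forall c, fsupp m c -> u c = 0.
Proof.
move=> Cm u0; split=> [/eqP|h].
  rewrite /fint big_seq psumr_eq0 => [/allP h c cm|pw /Cm[pw0 pwC]]; last first.
    by rewrite mulr_ge0 ?u0.
  have [/hasP[pw pwm /andP[/eqP pwc pw0]]|] :=
      boolP (has (fun pw => (pw.1 == c) && (0 < pw.2)) m).
    have := h pw pwm; rewrite pwm /= pwc mulf_eq0 => /orP[/eqP//|].
    by rewrite gt_eqF.
  move=> /hasPn none; move: cm; rewrite /fsupp /fmass big_seq_cond big1 ?ltxx //.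
  move=> pw /andP[pwm /= pwc]; have := none pw pwm; rewrite pwc /= -leNgt => pw0.
  by apply: le_anti; rewrite pw0; have [] := Cm pw pwm.
rewrite /fint big_seq; apply: big1 => pw pwm; have [pw0 pwC] := Cm pw pwm.
move: pw0; rewrite le_eqVlt => /predU1P[<-|pw0]; first by rewrite mulr0.
rewrite h ?mul0r // /fsupp /fmass (perm_big _ (perm_to_rem pwm)) big_cons /= eqxx.
rewrite ltr_wpDr // big_seq_cond; apply: sumr_ge0 => q /andP[/mem_rem/Cm[]//].
Qed.

(** [S] may exceed the atoms of [m], so that one list serves [mu] and all [nu s] together. *)
Lemma fint_atoms m (S : seq 'cV[R]_d) u : uniq S ->
  (forall pw, pw \in m -> pw.1 \in S) ->
  fint m u = \sum_(c <- S) fmass m (pred1 c) * u c.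
Proof.
move=> uS mS; under [RHS]eq_bigr do rewrite /fmass mulr_suml big_mkcond.
rewrite exchange_big /fint /= !big_seq; apply: eq_bigr => pw /mS pS.
rewrite (bigD1_seq pw.1) //= eqxx mulrC big1 ?addr0 // => c.
by rewrite eq_sym => /negPf ->.
Qed.

Lemma fint_r_mul k m (u : 'cV[R]_d -> 'rV[R]_k) (x : 'cV[R]_k) :
  (fint_r m u *m x) 0 0 = fint m (fun c => (u c *m x) 0 0).
Proof.
rewrite /fint_r mulmx_suml summxE; apply: eq_bigr => pw _.
by rewrite -scalemxAl mxE mulrC.
Qed.

End Measures.

(** * Entrywise order and scalar products *)

Section Slack.
Context (R : rcfType).

Lemma mxaddE k l (A B : 'M[R]_(k, l)) i j : (A + B) i j = A i j + B i j.
Proof. by rewrite mxE. Qed.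

Lemma mxsubE k l (A B : 'M[R]_(k, l)) i j : (A - B) i j = A i j - B i j.
Proof. by rewrite !mxE. Qed.

Lemma mxscaleE k l a (A : 'M[R]_(k, l)) i j : (a *: A) i j = a * A i j.
Proof. by rewrite mxE. Qed.

Lemma delta_dot n i (u : 'cV[R]_n) : ((delta_mx i (0 : 'I_1))^T *m u) 0 0 = u i 0.
Proof. by rewrite trmx_delta -rowE mxE. Qed.

Lemma zero_dot n (u : 'cV[R]_n) : ((0 : 'cV[R]_n)^T *m u) 0 0 = 0.
Proof. by rewrite trmx0 mul0mx mxE. Qed.

Lemma lev0P n k (v : 'M[R]_(n, k)) : lev 0 v <-> forall i j, 0 <= v i j.
Proof. by split=> h i j; have := h i j; rewrite mxE. Qed.

Lemma dot_ge0 n (u : 'rV[R]_n) (v : 'cV[R]_n) :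
  lev 0 u -> lev 0 v -> 0 <= (u *m v) 0 0.
Proof.
by move=> /lev0P u0 /lev0P v0; rewrite mxE; apply: sumr_ge0 => i _; rewrite mulr_ge0.
Qed.

Lemma lev_tr n k (u v : 'M[R]_(n, k)) : lev u v -> lev u^T v^T.
Proof. by move=> uv i j; rewrite !mxE. Qed.

Lemma lev0_tr n k (u : 'M[R]_(n, k)) : lev 0 u -> lev 0 u^T.
Proof. by move=> u0; rewrite -[0]trmx0; apply: lev_tr. Qed.

Lemma lev_subr n k (u v : 'M[R]_(n, k)) : lev 0 (v - u) <-> lev u v.
Proof. by split=> uv i j; have := uv i j; rewrite !mxE subr_ge0. Qed.

End Slack.

(** * Duality *)

Section Duality.
Context (R : rcfType) (d n1 n2 m1 m2 m : nat) (D : lp_data R d n1 n2 m1 m2 m).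
Context (alpha : R) (nz : nat) (r : 'I_nz -> R) (z : 'I_nz -> 'cV[R]_d).
Context (kC : nat) (P : 'M[R]_(kC, d)) (w : 'cV[R]_kC).
Hypotheses (alpha_ge0 : 0 <= alpha) (alpha_lt1 : alpha < 1).
Hypotheses (p_gt0 : forall s, 0 < pr D s) (p_sum1 : \sum_(s < m) pr D s = 1).
Hypotheses (r_ge0 : forall k, 0 <= r k) (r_sum1 : \sum_(k < nz) r k = 1).
Hypotheses (C_nonempty : exists c, inPoly P w c)
  (C_simplex : forall c, inPoly P w c -> inSimplex c).

Local Notation C := (inPoly P w).
Local Notation p := (pr D).
Local Notation rhoZ c := (CVaR r alpha (cZ z c)).
Local Notation rhoG x y c := (CVaR p alpha (cG D x y c)).
Local Notation PF := (primal_feas D alpha r z C).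
Local Notation PO := (primal_obj D).

Definition multipliers : Type :=
  'cV[R]_m1 * fsmeas R d * ('I_m -> fsmeas R d) * ('I_m -> 'cV[R]_m2).

Implicit Types (t : multipliers) (x : 'cV[R]_n1) (y : 'I_m -> 'cV[R]_n2).

Local Notation DF t := (dual_feas D alpha C t.1.1.1 t.1.1.2 t.1.2 t.2).
Local Notation DO t := (dual_obj D alpha r z t.1.1.1 t.1.1.2 t.2).

Let p_ge0 s : 0 <= p s. Proof. exact: ltW. Qed.

(** Dual feasibility without the two inequalities that involve the costs: what is left is a convex
    cone, so multipliers can be added and scaled. *)
Definition mult_cone t : Prop :=
  [/\ lev 0 t.1.1.1, fsm_on C t.1.1.2, forall s, fsm_on C (t.1.2 s),
      forall s, lev 0 (t.2 s) &
      (forall B, \sum_s p s * fmass (t.1.2 s) B = fmass t.1.1.2 B) /\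
      (forall s B, fmass (t.1.2 s) B <= fmass t.1.1.2 B / (1 - alpha))].

Definition mult0 : multipliers := (0, [::], fun=> [::], fun=> 0).
Definition multD t t' : multipliers :=
  (t.1.1.1 + t'.1.1.1, t.1.1.2 ++ t'.1.1.2, fun s => t.1.2 s ++ t'.1.2 s,
   fun s => t.2 s + t'.2 s).
Definition multZ (k : R) t : multipliers :=
  (k *: t.1.1.1, fscale k t.1.1.2, fun s => fscale k (t.1.2 s), fun s => k *: t.2 s).

(* [lag t x y] is the left-hand side and [bound t] the right-hand side of the
   combination of the primal constraints with multipliers [t]. *)
Definition lag t x y : R :=
  ((t.1.1.1)^T *m (Am D *m x)) 0 0
  - \sum_s p s * ((t.2 s)^T *m (Tm D s *m x + Wm D s *m y s)) 0 0
  + \sum_s p s * fint (t.1.2 s) (fun c => cG D x y c s).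

Definition bound t : R :=
  ((t.1.1.1)^T *m bv D) 0 0 - \sum_s p s * ((t.2 s)^T *m hv D s) 0 0
  + fint t.1.1.2 (fun c => rhoZ c).

Lemma dual_objE t : DO t = - bound t.
Proof. by rewrite /dual_obj /bound; ring. Qed.

Lemma mult_cone0 : mult_cone mult0.
Proof.
split=> /=; [by move=> i j | by move=> pw | by move=> s pw | by move=> s i j |].
split=> [B|s B]; rewrite /fmass !big_nil ?mul0r //.
by apply: big1 => s _; rewrite mulr0.
Qed.

Lemma mult_coneD t t' : mult_cone t -> mult_cone t' -> mult_cone (multD t t').
Proof.
move=> [l0 mC nC pi0 [e1 e2]] [l0' mC' nC' pi0' [e1' e2']]; split=> /=.
- by move=> i j; have := l0 i j; have := l0' i j; rewrite !mxE; lra.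
- exact: fsm_on_cat.
- by move=> s; apply: fsm_on_cat.
- by move=> s i j; have := pi0 s i j; have := pi0' s i j; rewrite !mxE; lra.
split=> [B|s B]; rewrite !fmass_cat.
  by rewrite -e1 -e1' -big_split; apply: eq_bigr => s _; rewrite fmass_cat mulrDr.
by rewrite mulrDl lerD.
Qed.

Lemma mult_coneZ k t : 0 <= k -> mult_cone t -> mult_cone (multZ k t).
Proof.
move=> k0 [l0 mC nC pi0 [e1 e2]]; split=> /=.
- by move=> i j; have := l0 i j; rewrite !mxE => h; rewrite mulr_ge0.
- exact: fsm_on_scale.
- by move=> s; apply: fsm_on_scale.
- by move=> s i j; have := pi0 s i j; rewrite !mxE => h; rewrite mulr_ge0.
split=> [B|s B]; rewrite !fmass_scale.
  by rewrite -e1 mulr_sumr; apply: eq_bigr => s _; rewrite fmass_scale mulrCA.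
by rewrite -mulrA ler_wpM2l.
Qed.

Lemma lag0 x y : lag mult0 x y = 0.
Proof.
rewrite /lag /= zero_dot !big1 ?subr0 ?addr0 // => s _.
  by rewrite /fint big_nil mulr0.
by rewrite zero_dot mulr0.
Qed.

Lemma bound0 : bound mult0 = 0.
Proof.
rewrite /bound /= zero_dot /fint big_nil big1 ?subr0 ?addr0 // => s _.
by rewrite zero_dot mulr0.
Qed.

Lemma lagD t t' x y : lag (multD t t') x y = lag t x y + lag t' x y.
Proof.
rewrite /lag /= [(_ + _)^T]linearD /= mulmxDl mxE.
under eq_bigr do rewrite [(_ + _)^T]linearD /= mulmxDl mxE mulrDr.
under [X in _ + X = _]eq_bigr do rewrite fint_cat mulrDr.
by rewrite !big_split /=; ring.
Qed.

Lemma boundD t t' : bound (multD t t') = bound t + bound t'.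
Proof.
rewrite /bound /= [(_ + _)^T]linearD /= mulmxDl mxE fint_cat.
under eq_bigr do rewrite [(_ + _)^T]linearD /= mulmxDl mxE mulrDr.
by rewrite !big_split /=; ring.
Qed.

Lemma lagZ k t x y : lag (multZ k t) x y = k * lag t x y.
Proof.
rewrite /lag /= [(_ *: _)^T]linearZ /= -scalemxAl mxE.
under eq_bigr do rewrite [(_ *: _)^T]linearZ /= -scalemxAl mxE mulrCA.
under [X in _ + X = _]eq_bigr do rewrite fint_scale mulrCA.
by rewrite -!mulr_sumr; ring.
Qed.

Lemma boundZ k t : bound (multZ k t) = k * bound t.
Proof.
rewrite /bound /= [(_ *: _)^T]linearZ /= -scalemxAl mxE fint_scale.
under eq_bigr do rewrite [(_ *: _)^T]linearZ /= -scalemxAl mxE mulrCA.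
by rewrite -!mulr_sumr; ring.
Qed.

(** Collecting the coefficients of [x] and of each [y s] leaves the slacks of the two cost
    inequalities of the dual. *)
Lemma primal_obj_lag t x y : PO x y + lag t x y =
  (((fv D)^T + (t.1.1.1)^T *m Am D - dual_lhs3 D t.1.2 t.2) *m x) 0 0
  + \sum_s p s * (((qv D s)^T - dual_lhs4 D t.1.2 t.2 s) *m y s) 0 0.
Proof.
have lhs3E : (dual_lhs3 D t.1.2 t.2 *m x) 0 0 =
    \sum_s p s * ((t.2 s)^T *m (Tm D s *m x)) 0 0
    - \sum_s p s * fint (t.1.2 s) (fun c => (c^T *m (gbar D s *m x)) 0 0).
  rewrite mulmxBl !mulmx_suml mxsubE !summxE.
  congr (_ - _); apply: eq_bigr => s _; rewrite -scalemxAl mxE ?mulmxA // fint_r_mul.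
  by congr (_ * _); apply: eq_bigr => pw _; rewrite mulmxA.
have lhs4E s : (dual_lhs4 D t.1.2 t.2 s *m y s) 0 0 =
    ((t.2 s)^T *m (Wm D s *m y s)) 0 0
    - fint (t.1.2 s) (fun c => (c^T *m (gtil D s *m y s)) 0 0).
  rewrite mulmxBl mxsubE fint_r_mul mulmxA.
  by congr (_ - _); apply: eq_bigr => pw _; rewrite mulmxA.
have cGE s : fint (t.1.2 s) (fun c => cG D x y c s) =
    fint (t.1.2 s) (fun c => (c^T *m (gbar D s *m x)) 0 0)
    + fint (t.1.2 s) (fun c => (c^T *m (gtil D s *m y s)) 0 0).
  rewrite /fint -big_split; apply: eq_bigr => pw _.
  by rewrite /cG /ghat mulmxDr mxE mulrDl.
rewrite mulmxBl mulmxDl mxsubE mxaddE lhs3E -[(t.1.1.1)^T *m _ *m x]mulmxA.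
under [X in _ = _ + X]eq_bigr do rewrite mulmxBl mxsubE lhs4E.
rewrite /PO /lag; under [X in _ + (_ - X + _) = _]eq_bigr do rewrite mulmxDr mxaddE mulrDr.
under [X in _ + (_ + X) = _]eq_bigr do rewrite cGE mulrDr.
under [X in _ = _ + X]eq_bigr do rewrite !mulrBr.
by rewrite !sumrB !big_split /=; ring.
Qed.

(** A linear form is nonnegative on the orthant exactly when its coefficients are; unit vectors
    recover the cost inequalities. *)
Lemma dual_feasE t : DF t <-> mult_cone t /\
  forall x y, lev 0 x -> (forall s, lev 0 (y s)) -> 0 <= PO x y + lag t x y.
Proof.
split=> [[l0 [mC [nC [pi0 [e1 [e2 [e3 e4]]]]]]]|[[l0 mC nC pi0 [e1 e2]] h]].
  split=> [//|x y x0 y0]; rewrite primal_obj_lag addr_ge0 //.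
    by apply: dot_ge0 => //; apply/lev_subr.
  by apply: sumr_ge0 => s _; rewrite mulr_ge0 //; apply: dot_ge0 => //; apply/lev_subr.
do 6!split=> //; split; last first.
  move=> s; apply/lev_subr => i j; rewrite (ord1 i) [leLHS]mxE.
  have := h 0 (fun s' => if s' == s then delta_mx j 0 else 0).
  rewrite primal_obj_lag mulmx0 mxE add0r (bigD1 s) //= eqxx -colE mxE.
  rewrite big1 ?addr0 => [|s' /negPf ->]; last by rewrite mulmx0 mxE mulr0.
  rewrite pmulr_rge0 //; apply=> [|s'] a b; first by rewrite mxE.
  by case: ifP; rewrite !mxE // ler0n.
apply/lev_subr => i j; rewrite (ord1 i) [leLHS]mxE.
have := h (delta_mx j 0) (fun=> 0).
rewrite primal_obj_lag -colE mxE big1 ?addr0 => [|s _]; last first.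
  by rewrite mulmx0 mxE mulr0.
by apply=> [|s'] a b; rewrite !mxE // ler0n.
Qed.

(** * Slacks, weak duality and complementary slackness *)

Definition atoms t : seq 'cV[R]_d :=
  undup (map fst t.1.1.2 ++ flatten [seq map fst (t.1.2 s) | s <- enum 'I_m]).

Lemma atoms_mu t pw : pw \in t.1.1.2 -> pw.1 \in atoms t.
Proof. by move=> h; rewrite mem_undup mem_cat map_f. Qed.

Lemma atoms_nu t s pw : pw \in t.1.2 s -> pw.1 \in atoms t.
Proof.
move=> h; rewrite mem_undup mem_cat; apply/orP; right; apply/flattenP.
by exists (map fst (t.1.2 s)); [apply: map_f; rewrite mem_enum | apply: map_f].
Qed.

(** The mass of [mu] at [c] is written as the mean of the masses of the [nu s], to which it is equal
    on [mult_cone]. *)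
Definition atom_slack t x y (c : 'cV[R]_d) : R :=
  rhoG x y c * Expect p (fun s => fmass (t.1.2 s) (pred1 c))
  - Expect p (fun s => fmass (t.1.2 s) (pred1 c) * cG D x y c s).

Lemma atom_slack_nonneg t x y c : mult_cone t -> 0 <= atom_slack t x y c.
Proof.
move=> [_ _ nC _ [e1 e2]]; apply: atom_slack_ge0 => // s.
  exact: fmass_ge0 (nC s).
by rewrite /Expect e1.
Qed.

Lemma slackE t x y : mult_cone t -> bound t - lag t x y =
  ((t.1.1.1)^T *m (bv D - Am D *m x)) 0 0
  + \sum_s p s * ((t.2 s)^T *m (Tm D s *m x + Wm D s *m y s - hv D s)) 0 0
  + fint t.1.1.2 (fun c => rhoZ c - rhoG x y c)
  + \sum_(c <- atoms t) atom_slack t x y c.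
Proof.
move=> [_ _ _ _ [e1 _]].
have -> : \sum_(c <- atoms t) atom_slack t x y c =
    fint t.1.1.2 (fun c => rhoG x y c)
    - \sum_s p s * fint (t.1.2 s) (fun c => cG D x y c s).
  rewrite sumrB; congr (_ - _).
    rewrite (fint_atoms (S := atoms t)) ?undup_uniq // => [|pw]; last exact: atoms_mu.
    by apply: eq_bigr => c _; rewrite /Expect e1 mulrC.
  rewrite exchange_big; apply: eq_bigr => s _ /=; rewrite -mulr_sumr; congr (_ * _).
  rewrite (fint_atoms (S := atoms t)) ?undup_uniq // => pw; exact: atoms_nu.
rewrite fintB mulmxBr mxsubE.
under [X in _ = _ + X + _ + _]eq_bigr do rewrite mulmxBr mxsubE mulrBr.
by rewrite sumrB /bound /lag; ring.
Qed.

Lemma primal_terms_ge0 t x y : mult_cone t -> PF x y ->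
  [/\ 0 <= ((t.1.1.1)^T *m (bv D - Am D *m x)) 0 0,
      forall s, 0 <= ((t.2 s)^T *m (Tm D s *m x + Wm D s *m y s - hv D s)) 0 0 &
      forall c, C c -> 0 <= rhoZ c - rhoG x y c].
Proof.
move=> [l0 _ _ pi0 _] [Ax x0 y0 TW rho]; split=> [|s|c cC].
- by apply: dot_ge0; [apply: lev0_tr | apply/lev_subr].
- by apply: dot_ge0; [apply: lev0_tr | apply/lev_subr].
- by rewrite subr_ge0 rho.
Qed.

Lemma lag_le_bound t x y : mult_cone t -> PF x y -> lag t x y <= bound t.
Proof.
move=> tc pf; have [h1 h2 h3] := primal_terms_ge0 tc pf.
rewrite -subr_ge0 slackE // !addr_ge0 //.
- by apply: sumr_ge0 => s _; rewrite mulr_ge0.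
- by case: tc => _ mC _ _ _; apply: fint_ge0 h3.
- by apply: sumr_ge0 => c _; apply: atom_slack_nonneg.
Qed.

Lemma weak_duality t x y : DF t -> PF x y -> DO t <= PO x y.
Proof.
move=> /dual_feasE[tc h] pf; have [_ x0 y0 _ _] := pf.
by rewrite dual_objE; have := h x y x0 y0; have := lag_le_bound tc pf; lra.
Qed.

Lemma psum_eq0 (F : 'I_m -> R) : (forall s, 0 <= F s) ->
  \sum_s p s * F s = 0 <-> forall s, F s = 0.
Proof.
move=> F0; split=> [/eqP|h]; last by apply: big1 => s _; rewrite h mulr0.
rewrite psumr_eq0 => [/allP h s|s _]; last by rewrite mulr_ge0.
by have := h s (mem_index_enum s); rewrite mulf_eq0 gt_eqF //= => /eqP.
Qed.

Lemma atom_slacks_eq0 t x y : mult_cone t ->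
  \sum_(c <- atoms t) atom_slack t x y c = 0 <->
  (forall s c, fsupp (t.1.2 s) c -> VaR_le p alpha (cG D x y c) (cG D x y c s)) /\
  (forall s c, 0 < fmass t.1.1.2 (pred1 c) / (1 - alpha) - fmass (t.1.2 s) (pred1 c) ->
     VaR_ge p alpha (cG D x y c) (cG D x y c s)).
Proof.
move=> tc; have [_ mC nC _ [e1 e2]] := tc.
have atomP c : atom_slack t x y c = 0 <->
    (forall s, fsupp (t.1.2 s) c -> VaR_le p alpha (cG D x y c) (cG D x y c s)) /\
    (forall s, 0 < fmass t.1.1.2 (pred1 c) / (1 - alpha) - fmass (t.1.2 s) (pred1 c) ->
     VaR_ge p alpha (cG D x y c) (cG D x y c s)).
  rewrite -e1; apply: (@atom_slack_eq0 R m p alpha p_ge0 p_sum1 alpha_ge0 alpha_lt1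
    (cG D x y c) (fun s => fmass (t.1.2 s) (pred1 c))) => // s.
    exact: fmass_ge0 (nC s).
  by have := e2 s (pred1 c); rewrite -e1.
split=> [/eqP|[h1 h2]]; last first.
  by apply: big1 => c _; apply/atomP; split=> s; [apply: h1 | apply: h2].
rewrite psumr_eq0 => [/allP h|c _]; last exact: atom_slack_nonneg.
(* Outside [atoms t] no [nu s] has mass, so the slack is zero there too. *)
have {}h c : atom_slack t x y c = 0.
  have [/h/eqP//|cS] := boolP (c \in atoms t).
  have nu0 s : fmass (t.1.2 s) (pred1 c) = 0.
    rewrite /fmass big_seq_cond big1 // => pw /andP[/atoms_nu pS /= /eqP pc].
    by rewrite pc (negPf cS) in pS.
  rewrite /atom_slack /Expect !big1 ?mulr0 ?subrr // => s _; rewrite nu0 ?mulr0 //.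
  by rewrite mul0r mulr0.
by split=> s c; have /atomP[h1 h2] := h c; [apply: h1 | apply: h2].
Qed.

Lemma gap_eq0 t x y : DF t -> PF x y ->
  PO x y = DO t <-> opt_conds D alpha r z x y t.1.1.1 t.1.1.2 t.1.2 t.2.
Proof.
move=> tf pf; have [tc _] := (dual_feasE t).1 tf.
have [h1 h2 h3] := primal_terms_ge0 tc pf; have [_ x0 y0 _ _] := pf.
have [_ mC _ _ _] := tc.
have [_ [_ [_ [_ [_ [_ [e3 e4]]]]]]] := tf.
have h4 := fint_ge0 mC h3.
have h5 : 0 <= \sum_(c <- atoms t) atom_slack t x y c.
  by apply: sumr_ge0 => c _; apply: atom_slack_nonneg.
have h6 : 0 <= (((fv D)^T + (t.1.1.1)^T *m Am D - dual_lhs3 D t.1.2 t.2) *m x) 0 0.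
  by apply: dot_ge0 => //; apply/lev_subr.
have h7 s : 0 <= (((qv D s)^T - dual_lhs4 D t.1.2 t.2 s) *m y s) 0 0.
  by apply: dot_ge0 => //; apply/lev_subr.
(* The first bracket consists of the reduced-cost terms in [x] and [y], the second of all the other
   slacks. *)
have gapE : PO x y - DO t = (PO x y + lag t x y) + (bound t - lag t x y).
  by rewrite dual_objE; ring.
rewrite primal_obj_lag slackE // in gapE.
have S2 : 0 <= \sum_s p s * ((t.2 s)^T *m (Tm D s *m x + Wm D s *m y s - hv D s)) 0 0.
  by apply: sumr_ge0 => s _; rewrite mulr_ge0.
have S7 : 0 <= \sum_s p s * (((qv D s)^T - dual_lhs4 D t.1.2 t.2 s) *m y s) 0 0.
  by apply: sumr_ge0 => s _; rewrite mulr_ge0.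
have P2 := psum_eq0 h2; have P7 := psum_eq0 h7.
have P4 := fint_eq0 mC h3; have P5 := atom_slacks_eq0 x y tc.
split=> [PD|[c1 [c2 [c3 [c4 [c5 [c6 c7]]]]]]].
  have h8 := P4.1 ltac:(lra).
  split; first by move=> c /h8/eqP; rewrite subr_eq0 => /eqP.
  have [? ?] := P5.1 ltac:(lra).
  do 2!split=> //; split; first by lra.
  by split; [apply: P2.1; lra | split; [lra | apply: P7.1; lra]].
have z4 := P4.2 (fun c sc => etrans (congr1 (fun u => _ - u) (c1 c sc)) (subrr _)).
have z2 := P2.2 c5; have z7 := P7.2 c7; have z5 := P5.2 (conj c2 c3).
lra.
Qed.

(* [f <= b] is a consequence, on the nonnegative orthant, of the combination of the
   constraints with multipliers [t] and of [PO <= v] with multiplier [tau]. *)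
Definition implied v (f : 'cV[R]_n1 -> ('I_m -> 'cV[R]_n2) -> R) (b : R) : Prop :=
  exists t tau, [/\ mult_cone t, 0 <= tau,
    forall x y, lev 0 x -> (forall s, lev 0 (y s)) ->
      f x y <= tau * PO x y + lag t x y & b = bound t + tau * v].

(** It turns a Farkas combination of the finitely many rows into a single multiplier [t] with a
    weight [tau] on the cost row. *)
Lemma implied_comb (I : Type) (js : seq I) v k f b :
  (forall i : I, 0 <= k i) -> (forall i, implied v (f i) (b i)) ->
  implied v (fun x y => \sum_(i <- js) k i * f i x y) (\sum_(i <- js) k i * b i).
Proof.
move=> k0 fb; elim: js => [|i js [t [tau [tc tau0 tf tb]]]].
  exists mult0, 0; rewrite big_nil bound0 mul0r addr0; split=> // [|x y _ _].
    exact: mult_cone0.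
  by rewrite big_nil lag0 mul0r addr0.
have [t' [tau' [tc' tau0' tf' tb']]] := fb i.
exists (multD (multZ (k i) t') t), (k i * tau' + tau); split.
- by apply: mult_coneD => //; apply: mult_coneZ.
- by rewrite addr_ge0 // mulr_ge0.
- move=> x y x0 y0; rewrite big_cons lagD lagZ.
  by have := ler_wpM2l (k0 i) (tf' x y x0 y0); have := tf x y x0 y0; lra.
- by rewrite big_cons boundD boundZ tb' tb; ring.
Qed.

Lemma primal_alternative v :
  (exists x y, PF x y /\ PO x y <= v) \/
  (exists t tau, [/\ mult_cone t, 0 <= tau,
    forall x y, lev 0 x -> (forall s, lev 0 (y s)) -> 0 <= tau * PO x y + lag t x y &
    bound t + tau * v < 0]).
Proof.
have [bs [bs_dens bsP]] := finite_densities p_ge0 p_sum1 alpha_ge0 alpha_lt1.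
have [cs [csC csP]] :=
  finite_benchmark z alpha_ge0 alpha_lt1 r_ge0 r_sum1 C_nonempty C_simplex.
pose Eb (b : 'cV[R]_m) := Expect p (fun s => b s 0).
pose EV (b : 'cV[R]_m) x y c := Expect p (fun s => b s 0 * cG D x y c s).
pose I : finType := ('I_m1 + 'I_m * 'I_m2 + seq_sub cs * seq_sub bs
  + ('I_n1 + 'I_m * 'I_n2 + unit))%type.
pose f (i : I) x y : R := match i with
  | inl (inl (inl i)) => (Am D *m x) i 0
  | inl (inl (inr si)) => - (Tm D si.1 *m x + Wm D si.1 *m y si.1) si.2 0
  | inl (inr cb) => EV (val cb.2) x y (val cb.1)
  | inr (inl (inl j)) => - x j 0
  | inr (inl (inr sj)) => - y sj.1 sj.2 0
  | inr (inr _) => PO x y end.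
pose b (i : I) : R := match i with
  | inl (inl (inl i)) => bv D i 0
  | inl (inl (inr si)) => - hv D si.1 si.2 0
  | inl (inr cb) => Eb (val cb.2) * rhoZ (val cb.1)
  | inr (inl _) => 0
  | inr (inr _) => v end.
(* The family [y] is stored as the columns of one matrix, to give Farkas' lemma a module of
   points. *)
pose a (i : I) (xY : 'cV[R]_n1 * 'M[R]_(n2, m)) := f i xY.1 (fun s => col s xY.2).
have affE l (M : 'M[R]_(l, n1)) (N : 'M[R]_(l, n2)) k x x' u u' :
    M *m (k *: x + x') + N *m (k *: u + u') =
    k *: (M *m x + N *m u) + (M *m x' + N *m u').
  by rewrite !mulmxDr -!scalemxAr scalerDr addrACA.
have colZ k (Y Y' : 'M[R]_(n2, m)) s : col s (k *: Y + Y') = k *: col s Y + col s Y'.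
  by rewrite linearP.
have cGZ k x x' Y Y' c s :
    cG D (k *: x + x') (fun s => col s (k *: Y + Y')) c s =
    k * cG D x (fun s => col s Y) c s + cG D x' (fun s => col s Y') c s.
  by rewrite /cG /ghat colZ affE [c^T *m (_ *: _ + _)]mulmxDr -scalemxAr !(mxaddE, mxscaleE).
have al i : scalar (a i).
  case: i => [[[i|[s i]]|[c e]]|[[j|[s j]]|[]]] k [x Y] [x' Y']; rewrite /a /f /=.
  - by rewrite mulmxDr -scalemxAr !mxE.
  - by rewrite colZ affE !(mxaddE, mxscaleE); ring.
  - rewrite /EV mulr_sumr -big_split; apply: eq_bigr => s _ /=.
    by rewrite cGZ; ring.
  - by rewrite !mxE; ring.
  - by rewrite !mxE; ring.
  - rewrite /PO mulmxDr -scalemxAr !(mxaddE, mxscaleE).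
    rewrite mulrDr mulr_sumr addrACA -big_split; congr (_ + _).
    apply: eq_bigr => s _ /=; rewrite colZ mulmxDr -scalemxAr.
    by rewrite !(mxaddE, mxscaleE); ring.
have delta0 i : lev 0 (delta_mx i 0 : 'cV[R]_m1).
  by move=> i' j; rewrite !mxE ler0n.
have implied_nonpos g : (forall x y, lev 0 x -> (forall s, lev 0 (y s)) -> g x y <= 0) ->
    implied v g 0.
  move=> g0; exists mult0, 0; rewrite bound0 mul0r addr0; split=> // [|x y x0 y0].
    exact: mult_cone0.
  by rewrite lag0 mul0r addr0 g0.
have fb i : implied v (f i) (b i).
  case: i => [[[i|[s i]]|[[c cC] [e eB]]]|[[j|[s j]]|[]]]; rewrite /f /b /=.
  - exists (delta_mx i 0, [::], fun=> [::], fun=> 0), 0; split=> //.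
    + split=> /=; [exact: delta0 | by move=> pw | by move=> s pw | by move=> s i' j |].
      by case: mult_cone0.
    + move=> x y _ _; rewrite mul0r add0r /lag /= delta_dot.
      rewrite !big1 ?subr0 ?addr0 // => s _; first by rewrite /fint big_nil mulr0.
      by rewrite zero_dot mulr0.
    + rewrite mul0r addr0 /bound /= delta_dot /fint big_nil.
      by rewrite big1 ?subr0 ?addr0 // => s _; rewrite zero_dot mulr0.
  (* The factor [(p s)^-1] cancels the weight [p s] carried by [pi s] in [lag] and [bound]. *)
  - pose pi s' : 'cV[R]_m2 := if s' == s then (p s)^-1 *: delta_mx i 0 else 0.
    have piE (u : 'I_m -> 'cV[R]_m2) : \sum_s' p s' * ((pi s')^T *m u s') 0 0 = u s i 0.
      rewrite (bigD1 s) //= /pi eqxx big1 => [|s' /negPf ->]; last first.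
        by rewrite zero_dot mulr0.
      by rewrite [(_ *: _)^T]linearZ /= -scalemxAl mxscaleE delta_dot addr0 mulVKf ?gt_eqF.
    exists (0, [::], fun=> [::], pi), 0; split=> //.
    + split=> /=; [by move=> i' j | by move=> pw | by move=> s' pw | |].
        move=> s' i' j; rewrite /pi; case: ifP => _; rewrite !mxE //.
        by rewrite mulr_ge0 ?invr_ge0 ?ler0n.
      by case: mult_cone0.
    + move=> x y _ _; rewrite mul0r add0r /lag /= piE zero_dot sub0r.
      by rewrite big1 ?addr0 // => s' _; rewrite /fint big_nil mulr0.
    + by rewrite mul0r addr0 /bound /= piE zero_dot sub0r /fint big_nil addr0.
  - exists (0, [:: (c, Eb e)], fun s => [:: (c, e s 0)], fun=> 0), 0.
    have [e0 e1] := bs_dens e eB.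
    have Eb0 : 0 <= Eb e by apply: sumr_ge0 => s _; rewrite mulr_ge0.
    split=> //.
    + split=> /=; [by move=> i' j | | | by move=> s i' j | ].
      * by move=> pw; rewrite inE => /eqP ->; split; [exact: Eb0 | exact: csC cC].
      * by move=> s pw; rewrite inE => /eqP ->; split; [exact: e0 | exact: csC cC].
      have fmass1 k B : fmass [:: (c, k)] B = k * (B c)%:R.
        by rewrite /fmass big_mkcond big_seq1 /=; case: (B c); rewrite ?mulr1 ?mulr0.
      (* The first constraint is the definition of [Eb e]; the second is the density inequality
         [(1 - alpha) * e s <= Eb e]. *)
      split=> [B|s B]; rewrite !fmass1.
        under eq_bigr do rewrite fmass1 mulrA.
        by rewrite -mulr_suml.
      by rewrite mulrAC ler_wpM2r // ler_pdivlMr ?subr_gt0 // mulrC.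
    + move=> x y _ _; rewrite mul0r add0r /lag /= zero_dot big1 => [|s _]; last first.
        by rewrite zero_dot mulr0.
      rewrite subr0 add0r /EV /Expect le_eqVlt; apply/orP; left; apply/eqP.
      by apply: eq_bigr => s _; rewrite /fint big_cons big_nil addr0 mulrC [e s 0 * _]mulrC mulrC.
    + rewrite mul0r addr0 /bound /= zero_dot big1 => [|s _]; last first.
        by rewrite zero_dot mulr0.
      by rewrite subr0 add0r /fint big_cons big_nil addr0 mulrC.
  - by apply: implied_nonpos => x y x0 _; have := x0 j 0; rewrite mxE; lra.
  - by apply: implied_nonpos => x y _ y0; have := y0 s j 0; rewrite mxE; lra.
  - exists mult0, 1; rewrite bound0 mul1r add0r; split=> //; first exact: mult_cone0.
    by move=> x y _ _; rewrite lag0 mul1r addr0.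
have [[[x Y] h]|none] := classic (exists xY, forall i, a i xY <= b i).
  left; exists x, (fun s => col s Y); split; last exact: h (inr (inr tt)).
  split.
  - by move=> i j; rewrite (ord1 j); apply: h (inl (inl (inl i))).
  - by move=> i j; rewrite (ord1 j) mxE -oppr_le0; apply: h (inr (inl (inl i))).
  - by move=> s i j; rewrite (ord1 j) mxE -oppr_le0; apply: h (inr (inl (inr (s, i)))).
  - by move=> s i j; rewrite (ord1 j) -lerN2; apply: h (inl (inl (inr (s, i)))).
  move=> c cC; apply: bsP => e eB; have [e0 _] := bs_dens e eB.
  (* For a fixed density [e], the rows at the points of [cs] extend to every [c] of the
     polyhedron. *)
  apply: (csP (EV e x (fun s => col s Y))) => // [k c1 c2||c' c'S].
  - rewrite /EV mulr_sumr -big_split; apply: eq_bigr => s _ /=.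
    by rewrite /cG linearP /= mulmxDl -scalemxAl !(mxaddE, mxscaleE); ring.
  - by apply: sumr_ge0 => s _; rewrite mulr_ge0.
  - exact: h (inl (inr (SeqSub c'S, SeqSub eB))).
have [k [k0 k1 k2]] := farkas_infeasible al none.
have [t [tau [tc tau0 tf tb]]] := implied_comb (index_enum I) k0 fb.
right; exists t, tau; split=> // [x y x0 y0|]; last by rewrite -tb.
have yE : (fun s => col s (\matrix_(i, s) y s i 0)) = y.
  by apply: functional_extensionality => s; apply/matrixP => i' j; rewrite (ord1 j) !mxE.
(* The Farkas combination vanishes identically, which leaves [0] on the left of the implied
   inequality. *)
have := tf x y x0 y0; have := k1 (x, \matrix_(i, s) y s i 0).
by rewrite /a /= yE => ->.
Qed.

Lemma certificate_feasible t tau : mult_cone t -> 0 < tau ->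
  (forall x y, lev 0 x -> (forall s, lev 0 (y s)) -> 0 <= tau * PO x y + lag t x y) ->
  DF (multZ tau^-1 t).
Proof.
move=> tc tau0 h; apply/dual_feasE; split=> [|x y x0 y0].
  by apply: mult_coneZ => //; rewrite invr_ge0 ltW.
rewrite lagZ -(pmulr_rge0 _ tau0) mulrDr mulrA divff ?gt_eqF // mul1r; exact: h.
Qed.

Lemma certificate_value t tau v : 0 < tau -> bound t + tau * v < 0 ->
  v < DO (multZ tau^-1 t).
Proof.
move=> tau0 h; rewrite dual_objE boundZ -mulrN mulrC ltr_pdivlMr //; lra.
Qed.

(** * Strong duality *)

Local Notation PFp := (fun xy => PF xy.1 xy.2).
Local Notation POp := (fun xy => PO xy.1 xy.2).

(** No primal point has value at most [v - e], so there is a certificate at that level; division by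
    its [tau] gives a dual point of value above [v - e]. *)
Lemma strong_duality_primal v :
  is_inf PFp POp v -> is_sup (fun t => DF t) (fun t => DO t) v.
Proof.
move=> [vmin vapx]; split=> [t tf|e e0].
  rewrite leNgt; apply/negP => lt; rewrite -subr_gt0 in lt.
  have [[x y] /= [pf]] := vapx _ lt; have := weak_duality tf pf; lra.
case: (primal_alternative (v - e)) => [[x [y [pf PO_le]]]|[t [tau [tc tau0 tf tb]]]].
  by have := vmin (x, y) pf; rewrite /=; lra.
have [[x y] /= [pf _]] := vapx 1 ltr01; have [_ x0 y0 _ _] := pf.
(* At a feasible point, [tau = 0] would give [0 <= lag t x y <= bound t], against [bound t < 0]. *)
have tau_gt0 : 0 < tau.
  rewrite lt_def tau0 andbT; apply: contraTneq tb => tauz.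
  have := tf x y x0 y0; have := lag_le_bound tc pf.
  by rewrite tauz !mul0r add0r addr0 -leNgt => h1 h2; apply: le_trans h1.
exists (multZ tau^-1 t); split; first exact: certificate_feasible.
exact: certificate_value.
Qed.

(** No certificate exists at the level [v + e / 2]: with [tau > 0] it scales to a dual point of
    value above [v], and with [tau = 0] it lifts some dual point above [v]. *)
Lemma strong_duality_dual v :
  is_sup (fun t => DF t) (fun t => DO t) v -> is_inf PFp POp v.
Proof.
move=> [vmax vapx]; split=> [[x y] pf|e e0].
  rewrite leNgt; apply/negP => lt; rewrite -subr_gt0 in lt.
  have [t [tf]] := vapx _ lt; have := weak_duality tf pf => /=; lra.
case: (primal_alternative (v + e / 2)) => [[x [y [pf PO_le]]]|[t [tau [tc tau0 tf tb]]]].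
  by exists (x, y); split=> //=; lra.
exfalso; move: tau0; rewrite le_eqVlt => /predU1P[tauz|tau_gt0]; last first.
  have := vmax _ (certificate_feasible tc tau_gt0 tf).
  by have := certificate_value tau_gt0 tb; lra.
rewrite -tauz mul0r addr0 in tb.
have [t0 [t0f t0v]] := vapx 1 ltr01; have [t0c t0h] := (dual_feasE t0).1 t0f.
(* [t] is a recession direction of the dual feasible set that improves the objective. *)
pose k := (- bound t)^-1.
have k0 : 0 < k by rewrite invr_gt0 oppr_gt0.
have /vmax : DF (multD t0 (multZ k t)).
  apply/dual_feasE; split=> [|x y x0 y0].
    by apply: mult_coneD => //; apply: mult_coneZ => //; apply: ltW.
  rewrite lagD lagZ addrA addr_ge0 ?t0h // mulr_ge0 ?(ltW k0) //.
  by have := tf x y x0 y0; rewrite -tauz mul0r add0r.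
(* By the choice of [k] the dual value rises by exactly 1, and [t0] was within 1 of [v]. *)
rewrite dual_objE boundD boundZ /k invrN mulNr mulVf ?lt_eqF //.
rewrite dual_objE in t0v; lra.
Qed.

End Duality.

(** * Equality of the optimum values and the optimality conditions *)

Theorem theorem1 (R : rcfType) (d n1 n2 m1 m2 m : nat)
  (D : lp_data R d n1 n2 m1 m2 m) (alpha : R)
  (nz : nat) (r : 'I_nz -> R) (z : 'I_nz -> 'cV[R]_d)
  (kC : nat) (P : 'M[R]_(kC, d)) (w : 'cV[R]_kC)
  (Halpha0 : 0 <= alpha) (Halpha1 : alpha < 1)
  (Hp : forall s, 0 < pr D s) (Hp1 : \sum_(s < m) pr D s = 1)
  (Hr : forall k, 0 <= r k) (Hr1 : \sum_(k < nz) r k = 1)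
  (HCne : exists c, inPoly P w c)
  (HCsimplex : forall c, inPoly P w c -> inSimplex c) :
  let C := inPoly P w in
  let PF := fun xy : 'cV[R]_n1 * ('I_m -> 'cV[R]_n2) =>
              primal_feas D alpha r z C xy.1 xy.2 in
  let PO := fun xy : 'cV[R]_n1 * ('I_m -> 'cV[R]_n2) => primal_obj D xy.1 xy.2 in
  let DF := fun t : 'cV[R]_m1 * fsmeas R d * ('I_m -> fsmeas R d) * ('I_m -> 'cV[R]_m2) =>
              dual_feas D alpha C t.1.1.1 t.1.1.2 t.1.2 t.2 in
  let DO := fun t : 'cV[R]_m1 * fsmeas R d * ('I_m -> fsmeas R d) * ('I_m -> 'cV[R]_m2) =>
              dual_obj D alpha r z t.1.1.1 t.1.1.2 t.2 in
  [/\ ((exists v, is_inf PF PO v) <-> (exists v, is_sup DF DO v)),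
      (forall v v', is_inf PF PO v -> is_sup DF DO v' -> v = v') &
      (forall x y lam mu nu pi,
         PF (x, y) -> DF (lam, mu, nu, pi) ->
         ((forall xy, PF xy -> PO (x, y) <= PO xy) /\
          (forall t, DF t -> DO t <= DO (lam, mu, nu, pi))
          <-> opt_conds D alpha r z x y lam mu nu pi))].
Proof.
move=> C PF PO DF DO.
have P2D v : is_inf PF PO v -> is_sup DF DO v by exact: strong_duality_primal.
have D2P v : is_sup DF DO v -> is_inf PF PO v by exact: strong_duality_dual.
have sup_le v v' : is_sup DF DO v -> is_sup DF DO v' -> v <= v'.
  move=> [_ vapx] [v'max _]; rewrite leNgt; apply/negP => lt; rewrite -subr_gt0 in lt.
  by have [t [/v'max]] := vapx _ lt; lra.
split.
- by split=> -[v h]; exists v; [apply: P2D | apply: D2P].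
- by move=> v v' /P2D h h'; apply: le_anti; rewrite !sup_le.
move=> x y lam mu nu pi pf df.
have gap := gap_eq0 Halpha0 Halpha1 Hp Hp1 (t := (lam, mu, nu, pi)) df pf.
have wd t xy : DF t -> PF xy -> DO t <= PO xy by exact: weak_duality.
split=> [[xmin tmax]|/gap PD].
  apply/gap; apply: le_anti; rewrite (wd _ _ df pf) andbT.
  (* The primal optimum is attained at [(x, y)], so its value is also the dual supremum; a gap would
     yield a dual point better than the optimal one. *)
  have [_ vapx] : is_sup DF DO (PO (x, y)).
    by apply: P2D; split=> // e e0; exists (x, y); split=> //; rewrite ltrDl.
  rewrite leNgt; apply/negP => lt; rewrite -subr_gt0 in lt.
  by have [t [/tmax]] := vapx _ lt; rewrite /PO /DO /=; lra.
split=> [xy pf'|t tf]; first by rewrite {1}/PO /= PD; apply: wd df pf'.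
by rewrite {2}/DO /= -PD; apply: wd tf pf.
Qed.
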